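(* Let $\mathcal G$ be a separated Rota-Baxter hierarchy over a field $K$. Then every element of the ring of partial integral operators $\mathcal G[\int]$ is a $K$-linear combination of terms $b\,M^*J_1\cdots J_r$ ($r\ge0$), where $b\in\mathcal G$ is a basis element, $M\in\mathcal M(K)$ has $i_1$-th row $M_{i_1\bullet}\ne0$ if $r>0$, and $J_1,\dots,J_r$ are line integrators of indices $i_1<\cdots<i_r$.
   Context: $K$ is a field of characteristic zero. The algebra $\mathcal G$ is commutative and unital; all bialgebras are commutative and cocommutative. Rota-Baxter operators have weight zero: a linear operator $P$ with $P(u)P(v)=P(uP(v))+P(P(u)v)$. A Rota-Baxter algebra $(G,P)$ over $K$ is ordinary if $P$ is injective and $G=K\oplus\operatorname{im}P$. Matrices. $\mathcal M(K)$ is the monoid of infinite matrices (indexed by $1,2,\dots$) of the form $I+\tilde M$ with $\tilde M$ having finitely many nonzero rows and columns; $M\in\mathcal M_n(K)=K^{n\times n}$ is identified with $\mathrm{diag}(M,I)$. $E_n:=I-e_{nn}$; $d_{i,\lambda}:=I+(\lambda-1)e_{ii}$. A row $a=(a_1,\dots,a_n)$ is identified with the matrix having first row $a$ and all further rows equal to those of $I$. For $w=(w_{i+1},\dots,w_n)^{\top}\in K^{n-i}$, $L_i(w):=I+\sum_{k>i}w_ke_{ki}$, so $L_i^{-1}(w)=L_i(-w)$; unit vectors $e_k\in K^{n-i}$ are numbered by position. For $w\in K^{n-j}$ and $i<j$, $L_{j-i}(w)$ acting on $K^{n-i}$ denotes the corresponding $(n-i)\times(n-i)$ matrix. Separated Rota-Baxter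 hierarchy. Let $(B,\Delta,\epsilon)$ be a $K$-bialgebra with product $\nabla$, unit $1$; put $\mathsf e:=1\circ\epsilon$ and $f\oplus g:=\nabla(f\otimes g)\Delta$ for linear endomorphisms. $(B,\Delta,\epsilon,\int)$ is a scaled Rota-Baxter bialgebra if $(B,\int)$ is an ordinary Rota-Baxter algebra over $K$, $\mathsf e$ is the projector onto $K$ along $\operatorname{im}\int$, $\Delta\int=(\int\otimes\mathrm{id})\Delta+(\mathsf e\otimes\mathrm{id})\Delta\int$, and there is a scaling $\lambda\mapsto\lambda^*$, i.e. a monoid homomorphism from $(K\setminus\{0\},\cdot)$ to bialgebra endomorphisms of $B$ such that, with $0^*:=\mathsf e$, $\lambda\mapsto\lambda^*$ is a semiring homomorphism $(K,+,\cdot)\to(\text{bialgebra endomorphisms},\oplus,\circ)$, and $\int\lambda^*=\lambda^{-1}\lambda^*\int$ for $\lambda\ne0$. The separated Rota-Baxter hierarchy $\mathcal G=\mathfrak H(B)$ is the direct limit of $\mathcal G_n=B^{\otimes n}$ (embedded in $\mathcal G_{n+1}$ by $f\mapsto f\otimes1$), with operators $\int^{x_n}=\mathrm{id}^{\otimes(n-1)}\otimes\int$ and matrix action $M^*(f_1\otimes\cdots\otimes f_n)=(M_{1\bullet}^*f_1)\cdots(M_{n\bullet}^*f_n)$ for $M\in\mathcal M_n(K)$, where $a^*:=(a_1^*\otimes\cdots\otimes a_n^* )\Delta^n:B\to B^{\otimes n}$ for a row $a$, and $\Delta^n$ is the iterated coproduct. Notation. $f[M]:=M^*(f)$; $f[i\;j]:=f[(i\;j)]$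 for transpositions (equal to $f$ if $i=j$), and $f[a]$ likewise for a row $a$. For $f\in\mathcal G_1$, $f(x_i):=(1\;i)^*f\in\mathcal G_{(i)}$, where $\mathcal G_{(i)}=(1\;i)^*\mathcal G_1$; $\mathcal G_\alpha$ is the subalgebra generated by the $\mathcal G_{(i)}$, $i\in\alpha$. Fix a $K$-basis of $\mathcal G_1$ containing $1$ and the induced tensor basis of $\mathcal G$; ''basis element'' refers to these. Tensor expansion: every $g\in\mathcal G_\alpha$ ($\alpha$ finite) is written (via the basis, with scalars absorbed in one component) as $g=\sum_{\mu=1}^r\prod_{j\in\alpha}g\{j\}_\mu$ with $g\{j\}_\mu\in\mathcal G_{(j)}$; for $\alpha=\{1,\dots,n\}$ put $g\{j\}'_\mu:=\prod_{k\ne j}g\{k\}_\mu$. For a sequence $\gamma$, $\gamma[M]$ is componentwise. Summation over repeated Greek indices is implied. Ring of partial integral operators. $\mathcal G[\int]$ is the quotient of the free product (coproduct of unital associative $K$-algebras) of $\mathcal G$, the opposite monoid algebra of $\mathcal M(K)$ (with basis elements $M^*$, so $M^*N^*=(NM)^*$), and the commutative polynomial ring $K[A_1,A_2,\dots]$, by the two-sided ideal generated by the following relations, for all positive integers $i,j$ (with $i<j$ in (3),(4),(7)), all $M\in\mathcal M(K)$ and $g,h\in\mathcal G_1$ (in (1): $g\in\mathcal G$); $n$ is any integer large enough for the matrices involved to lie in $\mathcal M_n(K)$: (1) $M^*g=g[M]M^*$. (2) $M^*A_i=0$ if the $i$-th row of $M$ is zero. (3) $A_j\,g(x_i)=g(x_i)A_j$.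 (4) $A_i\,g(x_j)=g(x_j)A_i$. (5) If $i:=\min\{k\mid M_{kj}\ne0\}$ exists: $A_j\,g(x_j)M^*=M_{ij}^{-1}\gamma'_\mu(1-E_j^* )\tilde M^*A_i\,\gamma[d_{j,1/M_{ij}}][i\;j]_\mu L_i(l)^*$, where $l=(l_{i+1},\dots,l_n)$, $l_k=M_{kj}/M_{ij}$, $\tilde M=L_i(-l)M$, $\gamma'=\tilde g\{j\}'$, $\gamma=\tilde g\{j\}$, and $\tilde g=g[a]$ for the row $a$ with $a_j=1$, $a_k=-M_{ik}/M_{ij}$ ($k\ne j$). (6) If the $j$-th column of $M$ is zero: $A_j\,g(x_j)M^*=\big(\int^{x_j}g(x_j)\big)M^*$. (7) For $v\in K^{n-i}$, $w\in K^{n-j}$: $A_jh(x_j)L_j(w)^*A_i\,g(x_i)L_i(v)^*=(1-E_j^* )A_i\,\eta'_\mu L_i(v')^*A_j\,\eta_\mu L_j(w)^*$, where $v'=L_{j-i}^{-1}(w)v$, $\eta'=g(x_i)\tilde h\{i\}$, $\eta=\tilde h\{j\}$, $\tilde h=h[e_j-v_je_i]\in\mathcal G_{(i,j)}$. (8) For $v,w\in K^{n-i}$, $w\ne0$: $A_ih(x_i)L_i(w)^*A_i\,g(x_i)L_i(v)^*=L_k^{-1}(w')^*\chi''[k\;n{+}1]_\mu\big(L_i(\bar w)^*A_i\,g(x_i)\chi'_\mu L_i(v')^*-A_i\,g(x_i)\chi'_\mu L_i(v'+\bar w)^*\big)A_k\,\chi_\mu L_k(w')^*$, where $k=\min\{m>i\mid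 w_m\ne0\}$, $\bar w=w_ke_{k-i}$, $w'=(w_{k+1},\dots,w_n)^\top/w_k$, $v'=L_{k-i}^{-1}(w')v$, $\tilde h=\frac1{w_k}h[-(v_k/w_k)e_i+e_k/w_k-e_{n+1}/w_k]\in\mathcal G_{(i,k,n+1)}$, $\chi''=\tilde h\{n+1\}$, $\chi'=\tilde h\{i\}$, $\chi=\tilde h\{k\}$. (9) $A_j\,g(x_j)A_j=\big(\int^{x_j}g(x_j)\big)A_j-A_j\big(\int^{x_j}g(x_j)\big)$. Line integrator. A line integrator of index $i$ is an element $A_i\,b(x_i)\,L_i(v)^*$ with $b$ a basis element of $\mathcal G_1$ and $v\in K^{n-i}$ for some $n\ge i$ (where $b=1$ or $L_i(v)=I$ means that the factor is absent). *)

(* Defs.v *)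
From HB Require Import structures.
From mathcomp Require Import all_boot all_algebra finmap generic_quotient.
From mathcomp Require Import boolp.
From mathcomp Require Import monalg.

Set Implicit Arguments.
Unset Strict Implicit.
Unset Printing Implicit Defensive.

Import GRing.Theory.
Local Open Scope ring_scope.
Local Open Scope quotient_scope.

Section Span.
Variables (K : fieldType) (V : lmodType K).
Implicit Types S : V -> Prop.

Inductive span S : V -> Prop :=
| span0 : span S 0
| span_gen x : S x -> span S x
| spanD x y : span S x -> span S y -> span S (x + y)
| spanZ c x : span S x -> span S (c *: x).

Definition lin_indep S := forall (n : nat) (s : 'I_n -> V) (c : 'I_n -> K),
  injective s -> (forall i, S (s i)) ->
  \sum_(i < n) c i *: s i = 0 -> forall i, c i = 0.

Definition is_basis S := (forall x, span S x) /\ lin_indep S.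

Lemma span_sum S (I : Type) (r : seq I) (P : pred I) (F : I -> V) :
  (forall i, P i -> span S (F i)) -> span S (\sum_(i <- r | P i) F i).
Proof.
move=> h; elim/big_rec: _ => [|i x Pi hx]; first exact: span0.
by apply: spanD => //; apply: h.
Qed.

Lemma spanN S x : span S x -> span S (- x).
Proof. by rewrite -scaleN1r; apply: spanZ. Qed.

Variable S : V -> Prop.

Definition span_eq (x y : V) : bool := `[< span S (x - y) >].

Lemma span_eq_refl : reflexive span_eq.
Proof. by move=> x; apply/asboolP; rewrite subrr; apply: span0. Qed.

Lemma span_eq_sym : symmetric span_eq.
Proof.
move=> x y; apply/asboolP/asboolP => /spanN; by rewrite opprB.
Qed.

Lemma span_eq_trans : transitive span_eq.
Proof.
move=> y x z /asboolP hxy /asboolP hyz; apply/asboolP.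
by rewrite -(subrK y x) -addrA; apply: spanD.
Qed.

Canonical span_equiv := EquivRel span_eq span_eq_refl span_eq_sym span_eq_trans.

(* [qmod S] is the quotient of [V] by the subspace spanned by [S]. *)
Definition qmod := {eq_quot span_equiv}.
HB.instance Definition _ := Choice.on qmod.
HB.instance Definition _ := EqQuotient.on qmod.

End Span.

(* The operations are locked, because unification would otherwise unfold them
   down to the implementation of [{eq_quot _}]. *)
HB.lock Definition qproj (K : fieldType) (V : lmodType K) (S : V -> Prop)
  (x : V) : qmod S := \pi_(qmod S) x.
HB.lock Definition qadd (K : fieldType) (V : lmodType K) (S : V -> Prop)
  (x y : qmod S) : qmod S := qproj S (repr x + repr y).
HB.lock Definition qopp (K : fieldType) (V : lmodType K) (S : V -> Prop)
  (x : qmod S) : qmod S := qproj S (- repr x).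
HB.lock Definition qscale (K : fieldType) (V : lmodType K) (S : V -> Prop)
  (c : K) (x : qmod S) : qmod S := qproj S (c *: repr x).
Arguments qproj {K V} S x.
Arguments qadd {K V S} x y.
Arguments qopp {K V S} x.
Arguments qscale {K V S} c x.

Section Quotient.
Variables (K : fieldType) (V : lmodType K) (S : V -> Prop).
Local Notation qmod := (qmod S).
Local Notation qproj := (qproj S).
Local Notation qadd := (@qadd K V S).
Local Notation qopp := (@qopp K V S).
Local Notation qscale := (@qscale K V S).

Lemma qprojP x y : qproj x = qproj y <-> span S (x - y).
Proof.
rewrite qproj.unlock; split=> [/eqP|h].
  by rewrite eqmodE => /asboolP.
by apply/eqP; rewrite eqmodE; apply/asboolP.
Qed.

Lemma qrepr x : span S (repr (qproj x) - x).
Proof. by apply/qprojP; rewrite qproj.unlock reprK. Qed.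

Lemma qproj_surj (x : qmod) : exists y, x = qproj y.
Proof. by exists (repr x); rewrite qproj.unlock reprK. Qed.

Lemma qaddE x y : qadd (qproj x) (qproj y) = qproj (x + y).
Proof.
by rewrite qadd.unlock; apply/qprojP; rewrite opprD addrACA; apply: spanD; apply: qrepr.
Qed.

Lemma qoppE x : qopp (qproj x) = qproj (- x).
Proof. by rewrite qopp.unlock; apply/qprojP; rewrite -opprD; apply/spanN/qrepr. Qed.

Lemma qscaleE c x : qscale c (qproj x) = qproj (c *: x).
Proof. by rewrite qscale.unlock; apply/qprojP; rewrite -scalerBr; apply/spanZ/qrepr. Qed.

Lemma qaddA : associative qadd.
Proof.
move=> x y z; have [[[a ->] [b ->]] [c ->]] :=
  (qproj_surj x, qproj_surj y, qproj_surj z).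
by rewrite !qaddE addrA.
Qed.

Lemma qaddC : commutative qadd.
Proof.
move=> x y; have [[a ->] [b ->]] := (qproj_surj x, qproj_surj y).
by rewrite !qaddE addrC.
Qed.

Lemma qadd0 : left_id (qproj 0) qadd.
Proof. by move=> x; have [a ->] := qproj_surj x; rewrite qaddE add0r. Qed.

Lemma qaddN : left_inverse (qproj 0) qopp qadd.
Proof.
by move=> x; have [a ->] := qproj_surj x; rewrite qoppE qaddE addNr.
Qed.

HB.instance Definition _ := GRing.isZmodule.Build qmod qaddA qaddC qadd0 qaddN.

Lemma qscaleA a b (x : qmod) : qscale a (qscale b x) = qscale (a * b) x.
Proof. by have [v ->] := qproj_surj x; rewrite !qscaleE scalerA. Qed.

Lemma qscale1 : left_id 1 qscale.
Proof. by move=> x; have [v ->] := qproj_surj x; rewrite !qscaleE scale1r. Qed.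

Lemma qscaleDr : right_distributive qscale +%R.
Proof.
move=> c x y; have [[a ->] [b ->]] := (qproj_surj x, qproj_surj y).
by rewrite /GRing.add /= !(qscaleE, qaddE) scalerDr.
Qed.

Lemma qscaleDl (x : qmod) : {morph qscale^~ x : a b / a + b}.
Proof.
move=> a b; have [v ->] := qproj_surj x.
by rewrite /= [in RHS]/GRing.add /= !(qscaleE, qaddE) scalerDl.
Qed.

HB.instance Definition _ := GRing.Zmodule_isLmodule.Build K qmod
  qscaleA qscale1 qscaleDr qscaleDl.

Lemma qproj_is_linear : linear qproj.
Proof. by move=> c x y; rewrite -qaddE -qscaleE. Qed.

HB.instance Definition _ := GRing.isLinear.Build K V qmod *:%R qproj
  qproj_is_linear.

Lemma qprojE x : S x -> qproj x = 0.
Proof. by move=> Sx; apply/qprojP; rewrite subr0; apply: span_gen. Qed.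

End Quotient.

Section QuotientAlgebra.
Variables (K : fieldType) (A : lalgType K) (S : A -> Prop).

(* The linear span of [ideal_gen] is the two-sided ideal generated by [S]. *)
Definition ideal_gen (z : A) : Prop := exists a s b, S s /\ z = a * s * b.

Definition qalg := qmod ideal_gen.
HB.instance Definition _ := GRing.Lmodule.on qalg.

End QuotientAlgebra.

HB.lock Definition qmul (K : fieldType) (A : lalgType K) (S : A -> Prop)
  (x y : qalg S) : qalg S := qproj (ideal_gen S) (repr x * repr y).
Arguments qmul {K A S} x y.

Section QuotientAlgebraTheory.
Variables (K : fieldType) (A : lalgType K) (S : A -> Prop).
Local Notation ideal_gen := (ideal_gen S).
Local Notation qalg := (qalg S).
Local Notation qmul := (@qmul K A S).

Lemma idealZl a c x : span ideal_gen x -> span ideal_gen (a * (c *: x)).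
Proof.
move=> hx; elim: hx c => [|{}x [p [s [q [Ss ->]]]]|{}x y _ hx _ hy|d {}x _ hx] c.
- by rewrite scaler0 mulr0; apply: span0.
- apply: span_gen; exists (a * (c *: p)), s, q; split => //.
  by rewrite !scalerAl !mulrA.
- by rewrite scalerDr mulrDr; apply: spanD.
- by rewrite scalerA.
Qed.

Lemma idealMl a x : span ideal_gen x -> span ideal_gen (a * x).
Proof. by move=> /(idealZl a 1); rewrite scale1r. Qed.

Lemma idealMr a x : span ideal_gen x -> span ideal_gen (x * a).
Proof.
elim=> [|{}x [p [s [q [Ss ->]]]]|{}x y _ hx _ hy|d {}x _ hx].
- by rewrite mul0r; apply: span0.
- by apply: span_gen; exists p, s, (q * a); split => //; rewrite !mulrA.
- by rewrite mulrDl; apply: spanD.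
- by rewrite -scalerAl; apply: spanZ.
Qed.

Lemma qmulE a b :
  qmul (qproj ideal_gen a) (qproj ideal_gen b) = qproj ideal_gen (a * b).
Proof.
rewrite qmul.unlock; apply/qprojP; set a' := repr _; set b' := repr _.
have -> : a' * b' - a * b = (a' - a) * b' + a * (b' - b).
  by rewrite mulrBl mulrBr addrA subrK.
by apply: spanD; [apply: idealMr | apply: idealMl]; apply: qrepr.
Qed.

Lemma qalg_surj (x : qalg) : exists a, x = qproj ideal_gen a.
Proof. exact: qproj_surj. Qed.

Lemma qmulA : associative qmul.
Proof.
move=> x y z; have [[[a ->] [b ->]] [c ->]] :=
  (qalg_surj x, qalg_surj y, qalg_surj z).
by rewrite !qmulE mulrA.
Qed.

Lemma qmul1l : left_id (qproj ideal_gen 1) qmul.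
Proof. by move=> x; have [a ->] := qalg_surj x; rewrite qmulE mul1r. Qed.

Lemma qmul1r : right_id (qproj ideal_gen 1) qmul.
Proof. by move=> x; have [a ->] := qalg_surj x; rewrite qmulE mulr1. Qed.

Lemma qmulDl : left_distributive qmul +%R.
Proof.
move=> x y z; have [[[a ->] [b ->]] [c ->]] :=
  (qalg_surj x, qalg_surj y, qalg_surj z).
by rewrite -raddfD !qmulE -raddfD mulrDl.
Qed.

Lemma qmulDr : right_distributive qmul +%R.
Proof.
move=> x y z; have [[[a ->] [b ->]] [c ->]] :=
  (qalg_surj x, qalg_surj y, qalg_surj z).
by rewrite -raddfD !qmulE -raddfD mulrDr.
Qed.

HB.instance Definition _ := GRing.Zmodule_isPzRing.Build qalg
  qmulA qmul1l qmul1r qmulDl qmulDr.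

Definition qalg_proj (a : A) : qalg := qproj ideal_gen a.

Lemma qalg_proj_is_linear : linear qalg_proj.
Proof. exact: linearP. Qed.

HB.instance Definition _ := GRing.isLinear.Build K A qalg *:%R qalg_proj
  qalg_proj_is_linear.

Lemma qalg_proj_is_monoid_morphism : monoid_morphism qalg_proj.
Proof. by split=> // a b; rewrite /qalg_proj -qmulE. Qed.

HB.instance Definition _ := GRing.isMonoidMorphism.Build A qalg qalg_proj
  qalg_proj_is_monoid_morphism.

Lemma qalg_scaleAl (c : K) (x y : qalg) : c *: (x * y) = (c *: x) * y.
Proof.
have [[a ->] [b ->]] := (qalg_surj x, qalg_surj y).
rewrite -/(qalg_proj a) -/(qalg_proj b).
have pZ d v : d *: qalg_proj v = qalg_proj (d *: v) by rewrite linearZ.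
by rewrite -rmorphM !pZ -rmorphM scalerAl.
Qed.

Lemma qalg_projP x : (exists a, x = qalg_proj a).
Proof. exact: qproj_surj. Qed.

Lemma qalg_projE s : S s -> qalg_proj s = 0.
Proof.
by move=> Ss; apply: qprojE; exists 1, s, 1; rewrite mul1r mulr1.
Qed.

End QuotientAlgebraTheory.

Lemma malgUZ (K : fieldType) (T : choiceType) (c : K) (k : T) :
  << c *g k >> = c *: << k >> :> {malg K[T]}.
Proof. by apply/malgP => g; rewrite mcoeffZ !mcoeffU mulrnAr mulr1. Qed.

(* A pure tensor over the index set [I] is a family of elements of [B] that is
   almost everywhere [1]. *)
Definition family (K : fieldType) (B : comAlgType K) (I : choiceType) :=
  {fsfun I -> B with 1}.

HB.lock Definition upd (K : fieldType) (B : comAlgType K) (I : choiceType)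
    (f : family B I) (i : I) (a : B) : family B I :=
  [fsfun f with i |-> a].

HB.lock Definition fam_mul (K : fieldType) (B : comAlgType K) (I : choiceType)
    (f g : family B I) : family B I :=
  [fsfun i in (finsupp f `|` finsupp g)%fset => f i * g i | 1].

HB.lock Definition pure_malg (K : fieldType) (B : comAlgType K) (I : choiceType)
    (f : family B I) : {malg K[family B I]} := << f >>.

Arguments upd {K B I} f i a.
Arguments pure_malg {K B I} f.

Section TensorDef.
Variables (K : fieldType) (B : comAlgType K) (I : choiceType).
Local Notation family := (family B I).
Implicit Types (f g : family) (i : I).

Inductive multilin_rel : {malg K[family]} -> Prop :=
| multilinD f i a b : multilin_rel
    (pure_malg (upd f i (a + b)) -
     (pure_malg (upd f i a) + pure_malg (upd f i b)))
| multilinZ f i c a : multilin_rel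
    (pure_malg (upd f i (c *: a)) - c *: pure_malg (upd f i a)).

(* For a finite [I] this is the tensor power of [B] indexed by [I].  For an
   infinite [I] it is the direct limit of the tensor powers of [B] over the
   finite subsets of [I], along the embeddings that fill up with [1]; see
   [colim_universal] for [I = nat]. *)
Definition tensor := qmod multilin_rel.
HB.instance Definition _ := GRing.Lmodule.on tensor.

Definition multilinear (W : lmodType K) (m : family -> W) : Prop :=
  (forall f i a b, m (upd f i (a + b)) = m (upd f i a) + m (upd f i b)) /\
  (forall f i c a, m (upd f i (c *: a)) = c *: m (upd f i a)).

End TensorDef.

HB.lock Definition pure (K : fieldType) (B : comAlgType K) (I : choiceType)
  (f : family B I) : tensor B I := qproj (@multilin_rel K B I) (pure_malg f).

(* The linear map on [tensor] induced by a multilinear map. *)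
HB.lock Definition tlift (K : fieldType) (B : comAlgType K) (I : choiceType)
    (W : lmodType K) (m : family B I -> W) (x : tensor B I) : W :=
  let p := repr x in \sum_(f <- msupp p) p@_f *: m f.

Arguments upd {K B I} f i a.
Arguments fam_mul {K B I} f g.
Arguments pure_malg {K B I} f.
Arguments pure {K B I} f.
Arguments tlift {K B I W} m x.

Section Tensor.
Variables (K : fieldType) (B : comAlgType K) (I : choiceType).
Local Notation family := (family B I).
Local Notation tensor := (tensor B I).
Local Notation multilin_rel := (@multilin_rel K B I).
Implicit Types (f g : family) (i : I).

Definition fam1 : family := [fsfun with 1].

Section Lift.
Variables (W : lmodType K) (m : family -> W).

Definition malg_lift (p : {malg K[family]}) : W :=
  \sum_(f <- msupp p) p@_f *: m f.

Lemma malg_liftw (p : {malg K[family]}) (E : {fset family}) :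
  (msupp p `<=` E)%fset -> malg_lift p = \sum_(f <- E) p@_f *: m f.
Proof.
move=> sub; rewrite /malg_lift; apply: big_fset_incl => // f _ hf.
by rewrite mcoeff_outdom // scale0r.
Qed.

Lemma malg_lift_is_linear : linear malg_lift.
Proof.
move=> c p q; set E := (msupp p `|` msupp q)%fset.
rewrite (@malg_liftw p E) ?fsubsetUl // (@malg_liftw q E) ?fsubsetUr //.
rewrite (@malg_liftw _ E); last first.
  apply: fsubset_trans (msuppD_le _ _) _; apply: fsetSU; exact: msuppZ_le.
rewrite scaler_sumr -big_split /=; apply: eq_bigr => f _.
by rewrite mcoeffD mcoeffZ scalerDl scalerA.
Qed.

HB.instance Definition _ :=
  GRing.isLinear.Build K {malg K[family]} W *:%R malg_lift malg_lift_is_linear.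

Lemma malg_lift_pure f : malg_lift (pure_malg f) = m f.
Proof.
rewrite pure_malg.unlock (@malg_liftw _ [fset f]%fset) ?msuppU_le //.
by rewrite big_seq_fset1 mcoeffUU scale1r.
Qed.

Hypothesis mm : multilinear m.

Lemma malg_liftD p q : malg_lift (p + q) = malg_lift p + malg_lift q.
Proof. exact: (linearD (malg_lift : {linear _ -> _})). Qed.

Lemma malg_liftZ c p : malg_lift (c *: p) = c *: malg_lift p.
Proof. exact: (linearZ_LR (malg_lift : {linear _ -> _})). Qed.

Lemma malg_liftB p q : malg_lift (p - q) = malg_lift p - malg_lift q.
Proof. exact: (linearB (malg_lift : {linear _ -> _})). Qed.

Lemma malg_lift_rel p : span multilin_rel p -> malg_lift p = 0.
Proof.
elim=> [|{}p [f i a b|f i c a]|{}p q _ hp _ hq|c {}p _ hp].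
- exact: (linear0 (malg_lift : {linear _ -> _})).
- by rewrite malg_liftB malg_liftD !malg_lift_pure mm.1 subrr.
- by rewrite malg_liftB malg_liftZ !malg_lift_pure mm.2 subrr.
- by rewrite malg_liftD hp hq addr0.
- by rewrite malg_liftZ hp scaler0.
Qed.

Lemma tlift_qproj p : tlift m (qproj multilin_rel p) = malg_lift p.
Proof.
apply/eqP; rewrite -subr_eq0 tlift.unlock -/(malg_lift _) -malg_liftB.
by rewrite (malg_lift_rel (qrepr _ _)).
Qed.

Lemma tlift_is_linear : linear (tlift m).
Proof.
move=> c x y; have [[p ->] [q ->]] := (qproj_surj x, qproj_surj y).
by rewrite -linearP !tlift_qproj malg_liftD malg_liftZ.
Qed.

Lemma tlift_pure f : tlift m (pure f) = m f.
Proof. by rewrite pure.unlock tlift_qproj malg_lift_pure. Qed.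

End Lift.

Lemma pure_malgE f : pure_malg f = << f >>.
Proof. by rewrite pure_malg.unlock. Qed.

Lemma upd_eq f i a : upd f i a i = a.
Proof. by rewrite upd.unlock fsfun_with. Qed.

Lemma updE f i a j : upd f i a j = if j == i then a else f j.
Proof. by rewrite upd.unlock fsfun_withE. Qed.

Lemma fam1E i : fam1 i = 1.
Proof. exact: fsfun0E. Qed.

Lemma fam_mulE f g i : fam_mul f g i = f i * g i.
Proof.
rewrite fam_mul.unlock fsfunE inE.
case: (finsuppP f) => //=; case: (finsuppP g) => //= _ _; by rewrite mulr1.
Qed.

Lemma pure_multilinear : multilinear (@pure K B I).
Proof.
split=> [f i a b|f i c a]; rewrite pure.unlock.
  by rewrite -linearD; apply/qprojP/span_gen; exact: multilinD.
by rewrite -linearZ; apply/qprojP/span_gen; exact: multilinZ.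
Qed.

Lemma tensor_span x : span (fun y => exists f, y = pure f) x.
Proof.
have [p ->] := qproj_surj x; rewrite [p]monalgE linear_sum.
apply: span_sum => f _; rewrite malgUZ -pure_malgE.
by rewrite linearZ; apply/spanZ/span_gen; exists f; rewrite pure.unlock.
Qed.

Lemma tensor_ind (P : tensor -> Prop) :
  P 0 -> (forall f, P (pure f)) -> (forall x y, P x -> P y -> P (x + y)) ->
  (forall c x, P x -> P (c *: x)) -> forall x, P x.
Proof.
move=> P0 Pp PD PZ x.
elim: (tensor_span x) => [|{}x [f ->]|{}x y _ hx _ hy|c {}x _ hx] //.
- exact: PD.
- exact: PZ.
Qed.

Definition tmul (x y : tensor) : tensor :=
  tlift (fun f => tlift (fun g => pure (fam_mul f g)) y) x.

Lemma fam_mulC f g : fam_mul f g = fam_mul g f.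
Proof. by apply/fsfunP => i; rewrite !fam_mulE mulrC. Qed.

Lemma fam_mul_upd f g i a : fam_mul f (upd g i a) = upd (fam_mul f g) i (f i * a).
Proof.
by apply/fsfunP => j; rewrite fam_mulE !updE fam_mulE; case: eqP => [->|].
Qed.

Lemma tmulr_multilinear f : multilinear (fun g => pure (fam_mul f g)).
Proof.
split=> [g i a b|g i c a]; rewrite !fam_mul_upd.
  by rewrite mulrDr pure_multilinear.1.
by rewrite -scalerAr pure_multilinear.2.
Qed.

Lemma tliftD (W : lmodType K) (m : family -> W) x y : multilinear m ->
  tlift m (x + y) = tlift m x + tlift m y.
Proof. by move=> mm; rewrite -[x]scale1r (tlift_is_linear mm) !scale1r. Qed.

Lemma tlift0 (W : lmodType K) (m : family -> W) : multilinear m ->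
  tlift m 0 = 0.
Proof. by move=> mm; apply: (addIr (tlift m 0)); rewrite -tliftD // !add0r. Qed.

Lemma tliftZ (W : lmodType K) (m : family -> W) c x : multilinear m ->
  tlift m (c *: x) = c *: tlift m x.
Proof.
by move=> mm; rewrite -[c *: x]addr0 (tlift_is_linear mm) tlift0 // addr0.
Qed.

Lemma tmull_multilinear y :
  multilinear (fun f => tlift (fun g => pure (fam_mul f g)) y).
Proof.
have ml h := tmulr_multilinear h.
split=> [f i a b|f i c a]; elim/tensor_ind: y => [|g|x y hx hy|d x hx].
- by rewrite !(tlift0 (ml _)) addr0.
- rewrite !(tlift_pure (ml _)) ![fam_mul _ g]fam_mulC !fam_mul_upd mulrDr.
  by rewrite pure_multilinear.1.
- by rewrite !(tliftD x y (ml _)) hx hy addrACA.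
- by rewrite !(tliftZ d x (ml _)) hx scalerDr.
- by rewrite !(tlift0 (ml _)) scaler0.
- rewrite !(tlift_pure (ml _)) ![fam_mul _ g]fam_mulC !fam_mul_upd -scalerAr.
  by rewrite pure_multilinear.2.
- by rewrite !(tliftD x y (ml _)) hx hy scalerDr.
- by rewrite !(tliftZ d x (ml _)) hx !scalerA mulrC.
Qed.

Lemma tmul_pure f g : tmul (pure f) (pure g) = pure (fam_mul f g).
Proof.
rewrite /tmul tlift_pure; last exact: tmull_multilinear.
by rewrite tlift_pure //; apply: tmulr_multilinear.
Qed.

Lemma tmulDl : left_distributive tmul +%R.
Proof. by move=> x y z; rewrite /tmul tliftD //; apply: tmull_multilinear. Qed.

Lemma tmulZl c x y : tmul (c *: x) y = c *: tmul x y.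
Proof. by rewrite /tmul tliftZ //; apply: tmull_multilinear. Qed.

Lemma tmul0l x : tmul 0 x = 0.
Proof. by rewrite /tmul tlift0 //; apply: tmull_multilinear. Qed.

Lemma tmul_purer f x : tmul (pure f) x = tlift (fun g => pure (fam_mul f g)) x.
Proof. by rewrite /tmul tlift_pure //; apply: tmull_multilinear. Qed.

Lemma tmulDr : right_distributive tmul +%R.
Proof.
move=> x y z; elim/tensor_ind: x => [|f|a b ha hb|c a ha].
- by rewrite !tmul0l addr0.
- by rewrite !tmul_purer tliftD //; apply: tmulr_multilinear.
- by rewrite !tmulDl ha hb addrACA.
- by rewrite !tmulZl ha scalerDr.
Qed.

Lemma tmulZr c x y : tmul x (c *: y) = c *: tmul x y.
Proof.
elim/tensor_ind: x => [|f|a b ha hb|d a ha].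
- by rewrite !tmul0l scaler0.
- by rewrite !tmul_purer tliftZ //; apply: tmulr_multilinear.
- by rewrite !tmulDl ha hb scalerDr.
- by rewrite !tmulZl ha !scalerA mulrC.
Qed.

Lemma tmul0r x : tmul x 0 = 0.
Proof. by have := tmulZr 0 x 0; rewrite !scale0r. Qed.

Lemma tmulC : commutative tmul.
Proof.
move=> x y; elim/tensor_ind: x => [|f|a b ha hb|c a ha].
- by rewrite tmul0l tmul0r.
- elim/tensor_ind: y => [|g|a b ha hb|c a ha].
  + by rewrite tmul0l tmul0r.
  + by rewrite !tmul_pure fam_mulC.
  + by rewrite tmulDl tmulDr ha hb.
  + by rewrite tmulZl tmulZr ha.
- by rewrite tmulDl tmulDr ha hb.
- by rewrite tmulZl tmulZr ha.
Qed.

Lemma fam_mulA f g h : fam_mul f (fam_mul g h) = fam_mul (fam_mul f g) h.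
Proof. by apply/fsfunP => i; rewrite !fam_mulE mulrA. Qed.

Lemma fam_mul1 f : fam_mul fam1 f = f.
Proof. by apply/fsfunP => i; rewrite fam_mulE fam1E mul1r. Qed.

Lemma tmulA : associative tmul.
Proof.
move=> x y z; elim/tensor_ind: x => [|f|a b ha hb|c a ha].
- by rewrite !tmul0l.
- elim/tensor_ind: y => [|g|a b ha hb|c a ha].
  + by rewrite tmul0l !tmul0r tmul0l.
  + elim/tensor_ind: z => [|h|a b ha hb|c a ha].
    * by rewrite !tmul0r.
    * by rewrite !tmul_pure fam_mulA.
    * by rewrite !tmulDr ha hb.
    * by rewrite !tmulZr ha.
  + by rewrite tmulDl !tmulDr tmulDl ha hb.
  + by rewrite tmulZl !tmulZr tmulZl ha.
- by rewrite !tmulDl ha hb.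
- by rewrite !tmulZl ha.
Qed.

Lemma tmul1 : left_id (pure fam1) tmul.
Proof.
move=> x; elim/tensor_ind: x => [|f|a b ha hb|c a ha].
- by rewrite tmul0r.
- by rewrite tmul_pure fam_mul1.
- by rewrite tmulDr ha hb.
- by rewrite tmulZr ha.
Qed.

HB.instance Definition _ := GRing.Zmodule_isComPzRing.Build tensor
  tmulA tmulC tmul1 tmulDl.

Lemma pure_mul f g : pure f * pure g = pure (fam_mul f g).
Proof. exact: tmul_pure. Qed.

Lemma tensor_scaleAl (c : K) (x y : tensor) : c *: (x * y) = (c *: x) * y.
Proof. by rewrite -[RHS]/(tmul _ _) tmulZl. Qed.

(* The embedding of [B] as the [i]-th tensor factor. *)
Definition inj (i : I) (b : B) : tensor := pure (upd fam1 i b).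

End Tensor.

Notation tpow B n := (tensor B 'I_n).

Section TensorMaps.
Variables (K : fieldType) (B : comAlgType K).

(* [b_0 ⊗ ... ⊗ b_(n-1)] *)
Definition ptens n (b : 'I_n -> B) : tpow B n := \prod_(i < n) inj i (b i).

(* [phi_0 ⊗ ... ⊗ phi_(n-1)] *)
Definition tmap n (phi : 'I_n -> B -> B) : tpow B n -> tpow B n :=
  tlift (fun f => ptens (fun i => phi i (f i))).

Definition tmap2 (phi psi : B -> B) : tpow B 2 -> tpow B 2 :=
  tmap (fun i => if i == ord0 then phi else psi).

(* The algebra morphism that moves the [i]-th tensor factor to place [s i]. *)
Definition embed (I J : choiceType) (s : I -> J) : tensor B I -> tensor B J :=
  tlift (fun f => \prod_(i <- finsupp f) inj (s i) (f i)).

(* [D ⊗ id] and [id ⊗ D] for [D : B -> B^{⊗ n}] *)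
Definition tensl n (D : B -> tpow B n) : tpow B 2 -> tpow B n.+1 :=
  tlift (fun f => embed (widen_ord (leqnSn n)) (D (f ord0)) *
                  inj ord_max (f ord_max)).
Definition tensr n (D : B -> tpow B n) : tpow B 2 -> tpow B n.+1 :=
  tlift (fun f => inj ord0 (f ord0) * embed (lift ord0) (D (f ord_max))).

Definition swap : tpow B 2 -> tpow B 2 := embed (@rev_ord 2).

Definition nabla : tpow B 2 -> B := tlift (fun f => f ord0 * f ord_max).

End TensorMaps.

Section TensorMapsTheory.
Variables (K : fieldType) (B : comAlgType K).

Lemma pure1 (I : choiceType) : pure (fam1 B I) = 1.
Proof. by []. Qed.

Lemma inj_linear (I : choiceType) (i : I) : linear (@inj K B I i).
Proof.
have [hD hZ] := @pure_multilinear K B I.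
by move=> c a b; rewrite /inj hD hZ.
Qed.

Lemma inj1 (I : choiceType) (i : I) : inj i (1 : B) = 1.
Proof.
rewrite -pure1 /inj; congr pure; apply/fsfunP => j.
by rewrite updE fam1E if_same.
Qed.

Lemma injM (I : choiceType) (i : I) (a b : B) : inj i (a * b) = inj i a * inj i b.
Proof.
rewrite /inj pure_mul; congr pure; apply/fsfunP => j.
by rewrite fam_mulE !updE fam1E; case: eqP; rewrite ?mulr1.
Qed.

Lemma pureE (I : choiceType) (f : family B I) :
  pure f = \prod_(i <- finsupp f) inj i (f i).
Proof.
have prodE (r : seq I) (F : I -> family B I) :
    \prod_(i <- r) pure (F i) = pure (\big[fam_mul/fam1 B I]_(i <- r) F i).
  by elim: r => [|i r IH]; rewrite ?big_nil ?big_cons // IH pure_mul.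
have prodf (r : seq I) (F : I -> family B I) j :
    (\big[fam_mul/fam1 B I]_(i <- r) F i) j = \prod_(i <- r) F i j.
  by elim: r => [|i r IH]; rewrite ?big_nil ?big_cons ?fam1E // fam_mulE IH.
rewrite prodE; congr pure; apply/fsfunP => j; rewrite prodf.
have -> : \prod_(i <- finsupp f) upd (fam1 B I) i (f i) j =
          \prod_(i <- finsupp f) (if i == j then f j else 1).
  by apply: eq_bigr => i _; rewrite updE fam1E eq_sym; case: eqP => [->|].
case: (finsuppP f j) => [_|jf].
  by rewrite big1 // => i _; rewrite if_same.
rewrite (big_fsetD1 j) //= eqxx big_seq big1 ?mulr1 // => i.
by rewrite !inE; case: (i == j).
Qed.

Section ProductLift.
Variables (I J : choiceType) (phi : I -> B -> tensor B J).
Hypothesis phi_lin : forall i, linear (phi i).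
Hypothesis phi1 : forall i, phi i 1 = 1.

Lemma prod_liftw (f : family B I) (E : {fset I}) : (finsupp f `<=` E)%fset ->
  \prod_(i <- finsupp f) phi i (f i) = \prod_(i <- E) phi i (f i).
Proof.
move=> sub; apply: big_fset_incl => // i _ hi.
by rewrite fsfun_dflt ?phi1.
Qed.

Lemma prod_lift_upd (f : family B I) i a :
  \prod_(j <- finsupp (upd f i a)) phi j (upd f i a j) =
  phi i a * \prod_(j <- (finsupp f `\ i)%fset) phi j (f j).
Proof.
rewrite (@prod_liftw _ (i |` finsupp f)%fset); last first.
  apply/fsubsetP => j; rewrite in_fset1U !mem_finsupp updE.
  by case: (j == i).
rewrite (big_fsetD1 i) ?inE ?eqxx //= upd_eq; congr (_ * _).
have -> : ((i |` finsupp f) `\ i)%fset = (finsupp f `\ i)%fset.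
  by apply/fsetP => j; rewrite !inE; case: (j == i).
by apply: eq_big_seq => j; rewrite !inE updE => /andP [/negPf -> _].
Qed.

Lemma prod_lift_multilinear :
  multilinear (fun f => \prod_(i <- finsupp f) phi i (f i)).
Proof.
split=> [f i a b|f i c a]; rewrite !prod_lift_upd.
  by rewrite -[a]scale1r phi_lin !scale1r mulrDl.
have -> : phi i (c *: a) = c *: phi i a.
  have h0 : phi i 0 = 0.
    by have := phi_lin i (-1) 0 0; rewrite scaler0 addr0 scaleN1r addNr.
  by rewrite -[c *: a]addr0 phi_lin h0 addr0.
by rewrite -tensor_scaleAl.
Qed.

End ProductLift.

Lemma big_finsupp n (R : comPzRingType) (f : family B 'I_n) (F : 'I_n -> B -> R) :
  (forall i, F i 1 = 1) ->
  \prod_(i <- finsupp f) F i (f i) = \prod_(i < n) F i (f i).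
Proof.
move=> F1; rewrite big_uniq ?fset_uniq //=.
rewrite [RHS](bigID [pred i | i \in finsupp f]) /= [X in _ = _ * X]big1 ?mulr1 //.
by move=> i hi; rewrite fsfun_dflt ?F1.
Qed.

Lemma pure_ptens n (f : family B 'I_n) : pure f = ptens f.
Proof. by rewrite pureE big_finsupp // => i; apply: inj1. Qed.

Lemma linear0f (U V : lmodType K) (h : U -> V) : linear h -> h 0 = 0.
Proof.
by move=> hl; have := hl (-1) 0 0; rewrite scaler0 addr0 scaleN1r addNr.
Qed.

Lemma linearDf (U V : lmodType K) (h : U -> V) : linear h ->
  forall x y, h (x + y) = h x + h y.
Proof. by move=> hl x y; rewrite -[x]scale1r hl !scale1r. Qed.

Lemma linearZf (U V : lmodType K) (h : U -> V) : linear h ->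
  forall c x, h (c *: x) = c *: h x.
Proof. by move=> hl c x; rewrite -[c *: x]addr0 hl (linear0f hl) addr0. Qed.

Lemma ptens_multilinear n (phi : 'I_n -> B -> B) :
  (forall i, linear (phi i)) -> multilinear (fun f => ptens (fun i => phi i (f i))).
Proof.
move=> hl.
have H f i a : ptens (fun j => phi j (upd f i a j)) =
    inj i (phi i a) * \prod_(j < n | j != i) inj j (phi j (f j)).
  rewrite /ptens (bigD1 i) //= upd_eq; congr (_ * _).
  by apply: eq_bigr => j /negPf ji; rewrite updE ji.
split=> [f i a b|f i c a]; rewrite !H.
  by rewrite (linearDf (hl i)) (linearDf (@inj_linear _ i)) mulrDl.
by rewrite (linearZf (hl i)) (linearZf (@inj_linear _ i)) tensor_scaleAl.
Qed.

Lemma bilinear_multilinear (W : lmodType K) (h : B -> B -> W) :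
  (forall b, linear (h b)) -> (forall b, linear (h^~ b)) ->
  multilinear (fun f : family B 'I_2 => h (f ord0) (f ord_max)).
Proof.
move=> hl hr.
have H (i : 'I_2) : i = ord0 \/ i = ord_max.
  by case: i => [[|[|i]]] hi //; [left | right]; apply: val_inj.
split=> [f i a b|f i c a]; rewrite !updE; case: (H i) => -> /=.
- exact: (linearDf (hr _)).
- exact: (linearDf (hl _)).
- exact: (linearZf (hr _)).
- exact: (linearZf (hl _)).
Qed.

Lemma tmap_linear n (phi : 'I_n -> B -> B) :
  (forall i, linear (phi i)) -> linear (tmap phi).
Proof. by move=> hl; apply/tlift_is_linear/ptens_multilinear. Qed.

Lemma tmap_pure n (phi : 'I_n -> B -> B) f : (forall i, linear (phi i)) ->
  tmap phi (pure f) = ptens (fun i => phi i (f i)).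
Proof. by move=> hl; rewrite /tmap tlift_pure //; apply: ptens_multilinear. Qed.

Lemma embed_multilinear (I J : choiceType) (s : I -> J) :
  multilinear (fun f : family B I => \prod_(i <- finsupp f) inj (s i) (f i)).
Proof.
by apply: (@prod_lift_multilinear I J (fun i => inj (s i))) => i;
  [apply: inj_linear | apply: inj1].
Qed.

Lemma embed_linear (I J : choiceType) (s : I -> J) : linear (@embed K B I J s).
Proof. exact/tlift_is_linear/embed_multilinear. Qed.

Lemma embed_pure (I J : choiceType) (s : I -> J) (f : family B I) :
  embed s (pure f) = \prod_(i <- finsupp f) inj (s i) (f i).
Proof. by rewrite /embed tlift_pure //; apply: embed_multilinear. Qed.

Lemma embed1 (I J : choiceType) (s : I -> J) : embed s (1 : tensor B I) = 1.
Proof. by rewrite -pure1 embed_pure finsupp0 big_seq_fset0. Qed.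

Lemma embed_inj (I J : choiceType) (s : I -> J) i (b : B) :
  embed s (inj i b) = inj (s i) b.
Proof.
rewrite /inj embed_pure (prod_lift_upd (phi := fun i => inj (s i))).
  rewrite finsupp0 big_seq big1 ?mulr1 // => j; by rewrite !inE andbF.
by move=> j; apply: inj1.
Qed.

Lemma embedM (I J : choiceType) (s : I -> J) (x y : tensor B I) :
  embed s (x * y) = embed s x * embed s y.
Proof.
have el := @embed_linear I J s.
elim/tensor_ind: x => [|f|a b ha hb|c a ha].
- by rewrite mul0r (linear0f el) mul0r.
- elim/tensor_ind: y => [|g|a b ha hb|c a ha].
  + by rewrite mulr0 (linear0f el) mulr0.
  + have w := @prod_liftw I J (fun i => inj (s i)) (fun i => inj1 (s i)).
    rewrite pure_mul !embed_pure.
    rewrite !(@w _ (finsupp f `|` finsupp g)%fset) ?fsubsetUl ?fsubsetUr //.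
      by rewrite -big_split; apply: eq_bigr => i _; rewrite fam_mulE injM.
    apply/fsubsetP => i; rewrite inE !mem_finsupp fam_mulE.
    by apply: contraR; rewrite negb_or !negbK => /andP [/eqP -> /eqP ->]; rewrite mulr1.
  + by rewrite mulrDr !(linearDf el) ha hb mulrDr.
  + by rewrite mulrC -tensor_scaleAl !(linearZf el) mulrC ha mulrC
      tensor_scaleAl mulrC.
- by rewrite mulrDl !(linearDf el) ha hb mulrDl.
- by rewrite -tensor_scaleAl !(linearZf el) ha tensor_scaleAl.
Qed.

Lemma embed_prod (I J : choiceType) (s : I -> J) (T : Type) (r : seq T) F :
  embed s (\prod_(i <- r) F i : tensor B I) = \prod_(i <- r) embed s (F i).
Proof. by apply: big_morph; [apply: embedM | apply: embed1]. Qed.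

Section LiftD.
Variables (n : nat) (D : B -> tpow B n).
Hypothesis Dl : linear D.

Lemma tensl_multilinear : multilinear (fun f : family B 'I_2 =>
  embed (widen_ord (leqnSn n)) (D (f ord0)) * inj ord_max (f ord_max)).
Proof.
apply: (@bilinear_multilinear _ (fun a b =>
  embed (widen_ord (leqnSn n)) (D a) * inj ord_max b)) => b c x y /=.
  by rewrite inj_linear mulrDr mulrC -tensor_scaleAl mulrC.
by rewrite Dl embed_linear mulrDl -tensor_scaleAl.
Qed.

Lemma tensl_linear : linear (tensl D).
Proof. exact/tlift_is_linear/tensl_multilinear. Qed.

Lemma tensl_pure f : tensl D (pure f) =
  embed (widen_ord (leqnSn n)) (D (f ord0)) * inj ord_max (f ord_max).
Proof. by rewrite /tensl tlift_pure //; apply: tensl_multilinear. Qed.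

Lemma tensl1 : D 1 = 1 -> tensl D 1 = 1.
Proof. by move=> D1; rewrite -pure1 tensl_pure !fam1E D1 embed1 inj1 mulr1. Qed.

End LiftD.

Lemma tmapM n (phi : 'I_n -> {lrmorphism B -> B}) x y :
  tmap (fun i => phi i) (x * y) = tmap (fun i => phi i) x * tmap (fun i => phi i) y.
Proof.
have hl := tmap_linear (fun i => linearP (phi i)).
have hp f := tmap_pure f (fun i => linearP (phi i)).
elim/tensor_ind: x => [|f|a b ha hb|c a ha].
- by rewrite mul0r (linear0f hl) mul0r.
- elim/tensor_ind: y => [|g|a b ha hb|c a ha].
  + by rewrite mulr0 (linear0f hl) mulr0.
  + rewrite pure_mul !hp /ptens -big_split /=; apply: eq_bigr => i _.
    by rewrite fam_mulE rmorphM injM.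
  + by rewrite mulrDr !(linearDf hl) ha hb mulrDr.
  + by rewrite mulrC -tensor_scaleAl !(linearZf hl) mulrC ha mulrC
      tensor_scaleAl mulrC.
- by rewrite mulrDl !(linearDf hl) ha hb mulrDl.
- by rewrite -tensor_scaleAl !(linearZf hl) ha tensor_scaleAl.
Qed.

Lemma tmap1 n (phi : 'I_n -> {lrmorphism B -> B}) : tmap (fun i => phi i) 1 = 1.
Proof.
rewrite -pure1 tmap_pure => [|i]; last exact: linearP.
by rewrite /ptens big1 // => i _; rewrite fam1E rmorph1 inj1.
Qed.

Lemma tmap_prod n (phi : 'I_n -> {lrmorphism B -> B}) (I : Type) (r : seq I) F :
  tmap (fun i => phi i) (\prod_(i <- r) F i) =
  \prod_(i <- r) tmap (fun i => phi i) (F i).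
Proof. by apply: big_morph; [apply: tmapM | apply: tmap1]. Qed.

Lemma tmap_inj n (phi : 'I_n -> {lrmorphism B -> B}) j b :
  tmap (fun i => phi i) (inj j b) = inj j (phi j b).
Proof.
rewrite /inj tmap_pure => [|i]; last exact: linearP.
rewrite /ptens (bigD1 j) //= upd_eq big1 ?mulr1 // => i /negPf ij.
by rewrite updE ij fam1E rmorph1 inj1.
Qed.

End TensorMapsTheory.

Section DirectLimit.
Variables (K : fieldType) (B : comAlgType K).
Local Notation toG n := (embed (@nat_of_ord n)).
Local Notation step n := (embed (widen_ord (leqnSn n))).

Lemma colim_compat n (y : tpow B n) : toG n.+1 (step n y) = toG n y.
Proof.
have el := @embed_linear K B _ _ (@nat_of_ord n).
have el' := @embed_linear K B _ _ (@nat_of_ord n.+1).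
have es := @embed_linear K B _ _ (widen_ord (leqnSn n)).
elim/tensor_ind: y => [|f|a b ha hb|c a ha].
- by rewrite !linear0f.
- rewrite !embed_pure embed_prod; apply: eq_bigr => i _.
  by rewrite embed_inj.
- by rewrite (linearDf es) (linearDf el) (linearDf el') ha hb.
- by rewrite (linearZf es) (linearZf el) (linearZf el') ha.
Qed.

Definition restr (f : family B nat) n : tpow B n := ptens (fun i : 'I_n => f i).

Definition fbound (f : family B nat) : nat := \max_(i <- finsupp f) i.+1.

Lemma fboundP (f : family B nat) i : (fbound f <= i)%N -> f i = 1.
Proof.
move=> le_fi; apply: fsfun_dflt; apply/negP => hi.
have : (i < fbound f)%N by rewrite /fbound (big_fsetD1 i hi) /= leq_max leqnn.
by rewrite ltnNge le_fi.
Qed.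

Lemma toG_restr (f : family B nat) n : (fbound f <= n)%N ->
  toG n (restr f n) = pure f.
Proof.
move=> le_fn; rewrite /restr /ptens embed_prod pureE.
have -> : \prod_(i < n) toG n (inj i (f i)) = \prod_(i < n) inj (i : nat) (f i).
  by apply: eq_bigr => i _; rewrite embed_inj.
rewrite -(big_mkord xpredT (fun i => inj i (f i))) (bigID (mem (finsupp f))) /=.
rewrite [X in _ * X]big1 ?mulr1 => [|i hi]; last first.
  by rewrite fsfun_dflt ?inj1.
rewrite -big_filter; apply: perm_big; apply: uniq_perm.
- by rewrite filter_uniq ?iota_uniq.
- exact: fset_uniq.
move=> i; rewrite mem_filter mem_index_iota /=.
case: (boolP (i \in finsupp f)) => //= hi; rewrite ltnNge; apply/negP => le_ni.
by move: hi; rewrite mem_finsupp fboundP ?eqxx // (leq_trans le_fn).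
Qed.

Lemma step_iter n m (y : tpow B n) : (n <= m)%N ->
  exists z : tpow B m, toG m z = toG n y.
Proof.
elim: m => [|m IH] le_nm.
  by case: n y le_nm => // y _; exists y.
have [E|lt_nm] := eqVneq n m.+1; first by case: _ / E; exists y.
have [|z zE] := IH; first by rewrite -ltnS ltn_neqAle lt_nm.
by exists (step m z); rewrite colim_compat.
Qed.

Lemma colim_surj (x : tensor B nat) : exists n (y : tpow B n), x = toG n y.
Proof.
elim/tensor_ind: x => [|f|a b [n [y ->]] [m [z ->]]|c a [n [y ->]]].
- by exists 0%N, 0; rewrite linear0f //; apply: embed_linear.
- by exists (fbound f), (restr f (fbound f)); rewrite toG_restr.
- have [y' <-] := step_iter y (leq_maxl n m).
  have [z' <-] := step_iter z (leq_maxr n m).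
  by exists (maxn n m), (y' + z'); rewrite linearDf //; apply: embed_linear.
- by exists n, (c *: y); rewrite linearZf //; apply: embed_linear.
Qed.

Lemma colim_universal (W : lmodType K) (phi : forall n, tpow B n -> W) :
  (forall n, linear (phi n)) ->
  (forall n y, phi n.+1 (step n y) = phi n y) ->
  exists h : tensor B nat -> W,
    linear h /\ forall n (y : tpow B n), h (toG n y) = phi n y.
Proof.
move=> phil phiS.
have restrS (f : family B nat) n : (fbound f <= n)%N ->
    restr f n.+1 = step n (restr f n).
  move=> le_fn; rewrite /restr /ptens big_ord_recr /= fboundP // inj1 mulr1.
  by rewrite embed_prod; apply: eq_bigr => i _; rewrite embed_inj.
have phi_restr (f : family B nat) n : (fbound f <= n)%N ->
    phi n (restr f n) = phi (fbound f) (restr f (fbound f)).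
  elim: n => [|n IH]; first by rewrite leqn0 => /eqP ->.
  rewrite leq_eqVlt => /predU1P [<- //|lt_fn].
  by rewrite restrS // phiS IH.
pose m f := phi (fbound f) (restr f (fbound f)).
have mE f n : (fbound f <= n)%N -> m f = phi n (restr f n).
  by move=> h; rewrite phi_restr.
have restr_upd n (f : family B nat) (i : 'I_n) a : restr (upd f i a) n =
    inj i a * \prod_(j < n | j != i) inj j (f j).
  rewrite /restr /ptens (bigD1 i) //= upd_eq; congr (_ * _).
  by apply: eq_bigr => j ji; rewrite updE val_eqE (negPf ji).
have mm : multilinear m.
  split=> [f i a b|f i c a].
    pose n := maxn i.+1 (maxn (fbound (upd f i (a + b)))
      (maxn (fbound (upd f i a)) (fbound (upd f i b)))).
    rewrite !(mE _ n) /n ?leq_max ?leqnn ?orbT // -/n.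
    have lt_in : (i < n)%N by rewrite /n leq_max leqnn.
    rewrite -[i]/(val (Ordinal lt_in)) !restr_upd -(linearDf (phil n)) -mulrDl.
    by rewrite (linearDf (@inj_linear K B _ _)).
  pose n := maxn i.+1 (maxn (fbound (upd f i (c *: a))) (fbound (upd f i a))).
  rewrite !(mE _ n) /n ?leq_max ?leqnn ?orbT // -/n.
  have lt_in : (i < n)%N by rewrite /n leq_max leqnn.
  rewrite -[i]/(val (Ordinal lt_in)) !restr_upd -(linearZf (phil n)).
  by rewrite tensor_scaleAl (linearZf (@inj_linear K B _ _)).
have hl := tlift_is_linear mm.
exists (tlift m); split=> // n y.
have el := @embed_linear K B _ _ (@nat_of_ord n).
elim/tensor_ind: y => [|g|a b ha hb|c a ha].
- by rewrite (linear0f el) (linear0f hl) (linear0f (phil n)).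
- pose F : family B nat := [fsfun k in seq_fset tt (iota 0 n) =>
    if insub k is Some i then g (i : 'I_n) else 1 | 1].
  have Flt (i : 'I_n) : F i = g i.
    by rewrite fsfunE seq_fsetE mem_iota /= ltn_ord valK.
  have le_Fn : (fbound F <= n)%N.
    apply/bigmax_leqP_seq => i; rewrite mem_finsupp fsfunE seq_fsetE mem_iota.
    by rewrite leq0n add0n /=; case: ltnP => //; rewrite eqxx.
  have rF : restr F n = pure g.
    by rewrite pure_ptens /restr /ptens; apply: eq_bigr => i _; rewrite Flt.
  by rewrite -rF toG_restr // tlift_pure // (mE _ n).
- by rewrite (linearDf el) (linearDf hl) (linearDf (phil n)) ha hb.
- by rewrite (linearZf el) (linearZf hl) (linearZf (phil n)) ha.
Qed.

End DirectLimit.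

Record bialgebra (K : fieldType) (B : comAlgType K) := Bialgebra {
  comul : {lrmorphism B -> tpow B 2};
  counit : {lrmorphism B -> K | *%R};
  coassoc : forall b, tensl comul (comul b) = tensr comul (comul b);
  counitl : forall b,
    tlift (fun f => counit (f ord0) *: f ord_max) (comul b) = b;
  counitr : forall b,
    tlift (fun f => counit (f ord_max) *: f ord0) (comul b) = b;
  cocomm : forall b, swap (comul b) = comul b
}.

Section Bialgebra.
Variables (K : fieldType) (B : comAlgType K) (H : bialgebra B).

Definition counit_endo (b : B) : B := (counit H b)%:A.

Definition conv (phi psi : B -> B) (b : B) : B :=
  nabla (tmap2 phi psi (comul H b)).

Definition is_bialg_endo (phi : {lrmorphism B -> B}) : Prop :=
  (forall b, comul H (phi b) = tmap2 phi phi (comul H b)) /\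
  (forall b, counit H (phi b) = counit H b).

Fixpoint icomul n : B -> tpow B n :=
  if n is n'.+1 then fun b => tensl (icomul n') (comul H b)
  else fun b => counit H b *: (1 : tpow B 0).

End Bialgebra.

Definition is_Rota_Baxter (K : fieldType) (B : algType K)
    (P : {linear B -> B}) : Prop :=
  forall u v, P u * P v = P (u * P v) + P (P u * v).

(* [B] is the direct sum of the scalars and of the image of [P]. *)
Definition is_ordinary_RB (K : fieldType) (B : algType K)
    (P : {linear B -> B}) : Prop :=
  [/\ is_Rota_Baxter P, injective P,
      forall b : B, exists c u, b = c%:A + P u
    & forall c u, c%:A = P u :> B -> c = 0].

Record scaled_RB_bialgebra (K : fieldType) (B : comAlgType K) := ScaledRB {
  bialg :> bialgebra B;
  integ : {linear B -> B};
  integ_ordinary : is_ordinary_RB integ;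
  counit_projector : forall c u, counit_endo bialg (c%:A + integ u) = c%:A;
  comul_integ : forall b, comul bialg (integ b) =
    tmap2 integ id (comul bialg b) +
    tmap2 (counit_endo bialg) id (comul bialg (integ b));
  scal : K -> {lrmorphism B -> B};
  scal_bialg : forall c, c != 0 -> is_bialg_endo bialg (scal c);
  scal0 : scal 0 =1 counit_endo bialg;
  scal1 : scal 1 =1 id;
  scalM : forall c d, scal (c * d) =1 scal c \o scal d;
  scalD : forall c d, scal (c + d) =1 conv bialg (scal c) (scal d);
  integ_scal : forall c b, c != 0 ->
    integ (scal c b) = c^-1 *: scal c (integ b)
}.

(* Rows, columns and variables are numbered from [0], so [M_n(K)] and [G_n]
   involve the indices [i < n], and [n] is the index of the first variable that
   does not occur in [G_n]. *)

Definition supported_below (K : fieldType) (n : nat) (M : nat -> nat -> K) :=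
  forall i j, (n <= i)%N || (n <= j)%N -> M i j = (i == j)%:R.

Record imatrix (K : fieldType) := IMatrix {
  mentry :> nat -> nat -> K;
  mentryP : exists n, supported_below n mentry
}.

HB.instance Definition _ (K : fieldType) := gen_eqMixin (imatrix K).
HB.instance Definition _ (K : fieldType) := gen_choiceMixin (imatrix K).

Section Matrices.
Variable K : fieldType.
Implicit Types (M N : imatrix K).

Lemma imatrixP M N : (forall i j, M i j = N i j) -> M = N.
Proof.
case: M N => [M hM] [N hN] /= h.
have E : M = N by apply/funext => i; apply/funext => j; apply: h.
by case: _ / E hN h => hN _; congr IMatrix; apply: Prop_irrelevance.
Qed.

(* Some size [n] such that [M] belongs to [M_n(K)]. *)
Definition msize M : nat := sval (cid (mentryP M)).

Lemma msizeP M : supported_below (msize M) M.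
Proof. exact: svalP (cid (mentryP M)). Qed.

(* [diag(F, I)], where [F] is the [n * n] matrix with entries [F i j] *)
Definition mblock_fun n (F : nat -> nat -> K) i j : K :=
  if (i < n)%N && (j < n)%N then F i j else (i == j)%:R.

Lemma mblock_proof n F : exists m, supported_below m (mblock_fun n F).
Proof.
exists n => i j; rewrite /mblock_fun; case: (ltnP i n) => //= _.
by case: (ltnP j n).
Qed.

Definition mblock n F : imatrix K := IMatrix (mblock_proof n F).

Definition mid : imatrix K := mblock 0 (fun i j => (i == j)%:R).

Definition mmul M N : imatrix K :=
  let n := maxn (msize M) (msize N) in
  mblock n (fun i j => \sum_(k < n) M i k * N k j).

(* The matrix with first row [(a 0, ..., a n.-1)] *)
Definition mrow n (a : nat -> K) : imatrix K :=
  mblock n (fun i j => if i == 0%N then a j else (i == j)%:R).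

(* The transposition [(i j)] *)
Definition mtransp i j : imatrix K :=
  mblock (maxn i j).+1
    (fun r c => (c == if r == i then j else if r == j then i else r)%:R).

(* [E_i = I - e_ii] and [d_{i,c} = I + (c - 1) e_ii] *)
Definition mscale i (c : K) : imatrix K :=
  mblock i.+1 (fun r s => (r == s)%:R + (c - 1) *+ ((r == i) && (s == i))).
Definition mE i : imatrix K :=
  mblock i.+1 (fun r s => (r == s)%:R - ((r == i) && (s == i))%:R).

(* [L_i(w)].  The vector [w = (w_{i+1}, ..., w_n)] is given by a function of
   the row index, of which only the values on [i < k < n] matter. *)
Definition mL n i (w : nat -> K) : imatrix K :=
  mblock n (fun r s => (r == s)%:R + w r *+ ((i < r)%N && (s == i))).

(* The product [L_j(w) v] of [L_j(w)] with a column vector [v]. *)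
Definition mL_apply (j : nat) (w v : nat -> K) : nat -> K :=
  fun k => if (j < k)%N then v k + w k * v j else v k.

Definition vdelta (k : nat) (c : K) : nat -> K := fun r => c *+ (r == k).

End Matrices.

(* The direct limit of the [tpow B n] along [f |-> f ⊗ 1], by [colim_compat],
   [colim_surj] and [colim_universal] *)
Notation hierarchy B := (tensor B nat).

Section Hierarchy.
Variables (K : fieldType) (B : comAlgType K) (H : scaled_RB_bialgebra B).
Local Notation G := (hierarchy B).

(* [a^* : B -> B^{⊗ n}] for a row [a = (a 0, ..., a n.-1)], and its
   composition with the embedding into the hierarchy *)
Definition row_star n (a : nat -> K) (b : B) : tpow B n :=
  tmap (fun i => scal H (a i)) (icomul H n b).
Definition row_starG n (a : nat -> K) (b : B) : G :=
  embed (@nat_of_ord n) (row_star n a b).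

(* [M^*]; a tensor [f] is a product over its factors [f i != 1], and the [i]-th
   row of [M] is cut off at a length where all its further entries vanish. *)
Definition mact (M : imatrix K) : G -> G :=
  tlift (fun f => \prod_(i <- finsupp f)
                     row_starG (maxn (msize M) i.+1) (M i) (f i)).

(* [\int^{x_i}] *)
Definition integ_at (i : nat) : G -> G :=
  tlift (fun f => pure (upd f i (integ H (f i)))).

(* [B] is identified with [G_1] by [inj 0]; [var i b] is [b(x_i)]. *)
Definition var (i : nat) (b : B) : G := mact (mtransp K 0 i) (inj 0%N b).

(* The tensor basis of [G] that is induced by a basis of [G_1] *)
Definition tensor_basis (S : B -> Prop) (x : G) : Prop :=
  exists2 f : family B nat, forall i, S (f i) & x = pure f.

(* The equation [x = \sum_mu \prod_(j in alpha) (c mu j)(x_j)] expands [x] in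
   the tensor basis: for each [mu], the [c mu j] are basis elements, except that
   the coefficient of the term is absorbed in one of them. *)
Definition tensor_expansion (S : B -> Prop) (alpha : seq nat) (x : G)
    (r : nat) (c : 'I_r -> nat -> B) : Prop :=
  (forall mu, exists2 j0, j0 \in alpha & exists a : K, exists beta : nat -> B,
     forall j, j \in alpha ->
       S (beta j) /\ c mu j = (if j == j0 then a *: beta j else beta j)) /\
  x = \sum_mu \prod_(j <- alpha) var j (c mu j).

End Hierarchy.

Section HierarchyTheory.
Variables (K : fieldType) (B : comAlgType K) (H : scaled_RB_bialgebra B).
Local Notation G := (hierarchy B).

Lemma icomul_linear n : linear (icomul H n).
Proof.
elim: n => [|n IH] c x y /=; last by rewrite linearP (tensl_linear IH).
by rewrite linearP /= scalerDl scalerA.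
Qed.

Lemma icomul1 n : icomul H n 1 = 1.
Proof.
elim: n => [|n IH] /=; first by rewrite rmorph1 scale1r.
by rewrite rmorph1 tensl1 //; apply: icomul_linear.
Qed.

Lemma row_starG_linear n a : linear (row_starG H n a).
Proof.
move=> c x y; rewrite /row_starG /row_star icomul_linear tmap_linear => [|i].
  exact: embed_linear.
exact: linearP.
Qed.

Lemma row_starG1 n a : row_starG H n a 1 = 1.
Proof. by rewrite /row_starG /row_star icomul1 tmap1 embed1. Qed.

Lemma mact_linear M : linear (mact H M).
Proof.
apply/tlift_is_linear; pose phi i := row_starG H (maxn (msize M) i.+1) (M i).
apply: (@prod_lift_multilinear K B nat nat phi) => i.
  exact: row_starG_linear.
exact: row_starG1.
Qed.

Lemma mact_pure M (f : family B nat) : mact H M (pure f) =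
  \prod_(i <- finsupp f) row_starG H (maxn (msize M) i.+1) (M i) (f i).
Proof.
rewrite /mact tlift_pure //.
pose phi i := row_starG H (maxn (msize M) i.+1) (M i).
apply: (@prod_lift_multilinear K B nat nat phi) => i.
  exact: row_starG_linear.
exact: row_starG1.
Qed.

Lemma mact_inj M i b :
  mact H M (inj i b) = row_starG H (maxn (msize M) i.+1) (M i) b.
Proof.
rewrite /inj mact_pure.
rewrite (prod_lift_upd (phi := fun i => row_starG H (maxn (msize M) i.+1) (M i))).
  rewrite finsupp0 big_seq big1 ?mulr1 // => j; by rewrite !inE andbF.
by move=> j; apply: row_starG1.
Qed.

Lemma integ_at_multilinear i : multilinear
  (fun f : family B nat => pure (upd f i (integ H (f i)))).
Proof.
have [hD hZ] := @pure_multilinear K B nat.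
have E (f : family B nat) j a : upd (upd f j a) i (integ H (upd f j a i)) =
    if i == j then upd f i (integ H a) else upd (upd f i (integ H (f i))) j a.
  case: eqP => [->|/eqP ij].
    by apply/fsfunP => k; rewrite !updE eqxx; case: (k == j).
  apply/fsfunP => k; rewrite !updE (negPf ij).
  by case: (k =P i) => [->|//]; rewrite (negPf ij).
split=> [f j a b|f j c a]; rewrite !E; case: (i == j).
- by rewrite linearD hD.
- by rewrite hD.
- by rewrite linearZ hZ.
- by rewrite hZ.
Qed.

Lemma integ_at_linear i : linear (integ_at H i).
Proof. exact/tlift_is_linear/integ_at_multilinear. Qed.

Lemma integ_at_pure i (f : family B nat) :
  integ_at H i (pure f) = pure (upd f i (integ H (f i))).
Proof. by rewrite /integ_at tlift_pure //; apply: integ_at_multilinear. Qed.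

Lemma integ_at_inj i b : integ_at H i (inj i b) = inj i (integ H b).
Proof.
rewrite /inj integ_at_pure; congr pure; apply/fsfunP => k.
by rewrite !updE eqxx; case: (k == i).
Qed.

Lemma tmap_tensl n (phi : 'I_n.+1 -> {lrmorphism B -> B}) (D : B -> tpow B n) f :
  linear D ->
  tmap (fun i => phi i) (tensl D (pure f)) =
  embed (widen_ord (leqnSn n))
    (tmap (fun i => phi (widen_ord (leqnSn n) i)) (D (f ord0))) *
  inj ord_max (phi ord_max (f ord_max)).
Proof.
move=> Dl; rewrite tensl_pure // tmapM tmap_inj; congr (_ * _).
have hl := tmap_linear (fun i => linearP (phi i)).
have hl' := tmap_linear (fun i => linearP (phi (widen_ord (leqnSn n) i))).
have el := @embed_linear K B _ _ (widen_ord (leqnSn n)).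
elim/tensor_ind: (D (f ord0)) => [|g|a b ha hb|c a ha].
- by rewrite (linear0f hl') (linear0f el) (linear0f hl).
- rewrite embed_pure tmap_prod pureE !tmap_prod.
  rewrite embed_prod; apply: eq_bigr => i _.
  by rewrite !tmap_inj embed_inj.
- by rewrite !(linearDf el) !(linearDf hl) !(linearDf hl') !(linearDf el) ha hb.
- by rewrite !(linearZf el) !(linearZf hl) !(linearZf hl') !(linearZf el) ha.
Qed.

Lemma tensor_ext (I : choiceType) (W : lmodType K) (h k : tensor B I -> W) :
  linear h -> linear k -> (forall f, h (pure f) = k (pure f)) -> h =1 k.
Proof.
move=> hl kl e; elim/tensor_ind => [|f|a b ha hb|c a ha].
- by rewrite !linear0f.
- exact: e.
- by rewrite !linearDf // ha hb.
- by rewrite !linearZf // ha.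
Qed.

Let counit_lift_l := tlift (fun f : family B 'I_2 => counit H (f ord0) *: f ord_max).
Let counit_lift_r := tlift (fun f : family B 'I_2 => counit H (f ord_max) *: f ord0).

Let counit_multi_l :
  multilinear (fun f : family B 'I_2 => counit H (f ord0) *: f ord_max).
Proof.
apply: (@bilinear_multilinear K B B (fun u v => counit H u *: v)) => u c x y /=.
  by rewrite scalerDr !scalerA mulrC.
by rewrite linearP scalerDl /= !scalerA.
Qed.

Let counit_multi_r :
  multilinear (fun f : family B 'I_2 => counit H (f ord_max) *: f ord0).
Proof.
apply: (@bilinear_multilinear K B B (fun u v => counit H v *: u)) => u c x y /=.
  by rewrite linearP scalerDl /= !scalerA.
by rewrite scalerDr !scalerA mulrC.
Qed.

Lemma tmap_icomulS n (phi : 'I_n.+1 -> {lrmorphism B -> B}) (k : tpow B 2 -> tpow B n.+1) :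
  linear k ->
  (forall f, k (pure f) = embed (widen_ord (leqnSn n))
    (tmap (fun i => phi (widen_ord (leqnSn n) i)) (icomul H n (f ord0))) *
    inj ord_max (phi ord_max (f ord_max))) ->
  forall b, tmap (fun i => phi i) (icomul H n.+1 b) = k (comul H b).
Proof.
move=> kl kE b /=; have Dl := icomul_linear n.
have hl := tmap_linear (fun i => linearP (phi i)).
apply: (tensor_ext (h := fun x => tmap (fun i => phi i) (tensl (icomul H n) x))).
- by move=> c x y; rewrite (tensl_linear Dl) hl.
- exact: kl.
- by move=> f; rewrite tmap_tensl.
Qed.

Lemma tmap_scal0 n (a : 'I_n -> K) b : (forall i, a i = 0) ->
  tmap (fun i => scal H (a i)) (icomul H n b) = counit H b *: (1 : tpow B n).
Proof.
elim: n a b => [|n IH] a b a0 /=.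
  have hl := tmap_linear (fun i => linearP (scal H (a i))).
  by rewrite (linearZf hl) (tmap1 (fun i => scal H (a i))).
have hl := tmap_linear (fun i => linearP (scal H (a i))).
rewrite -/(icomul H n.+1 b).
pose k (x : tpow B 2) : tpow B n.+1 := counit H (counit_lift_l x) *: (1 : tpow B n.+1).
rewrite (@tmap_icomulS n (fun i => scal H (a i)) k).
- by rewrite /k /counit_lift_l counitl.
- move=> c x y; rewrite /k /counit_lift_l (tlift_is_linear counit_multi_l).
  by rewrite linearP scalerDl /= scalerA.
- move=> f; rewrite /k /counit_lift_l tlift_pure // IH // a0 scal0.
  rewrite (linearZf (@embed_linear K B _ _ _)) embed1 /counit_endo.
  rewrite (linearZf (@inj_linear K B _ _)) inj1 linearZ /=.
  by rewrite mulrC -tensor_scaleAl mul1r scalerA mulrC.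
Qed.

Lemma tmap_scal_delta n (a : 'I_n -> K) (i : 'I_n) b :
  (forall j, a j = (j == i)%:R) ->
  tmap (fun i => scal H (a i)) (icomul H n b) = inj i b.
Proof.
elim: n a i b => [|n IH] a i b aE; first by case: i aE.
case: (eqVneq i ord_max) aE => [->|ni] aE.
  rewrite (@tmap_icomulS n (fun i => scal H (a i))
            (fun x => inj ord_max (counit_lift_l x))).
  - by rewrite /counit_lift_l counitl.
  - move=> c x y; rewrite /counit_lift_l (tlift_is_linear counit_multi_l).
    exact: inj_linear.
  - move=> f; rewrite /counit_lift_l tlift_pure // aE eqxx scal1.
    rewrite tmap_scal0 => [|j]; last first.
      by rewrite aE -val_eqE /= ltn_eqF.
    rewrite (linearZf (@embed_linear K B _ _ _)) embed1.
    by rewrite (linearZf (@inj_linear K B _ _)) -tensor_scaleAl mul1r.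
have lt_i : (i < n)%N.
  by rewrite ltn_neqAle -ltnS ltn_ord andbT; move: ni; rewrite -val_eqE.
pose i' := Ordinal lt_i; have wi : widen_ord (leqnSn n) i' = i by apply: val_inj.
rewrite (@tmap_icomulS n (fun i => scal H (a i))
            (fun x => inj i (counit_lift_r x))).
- by rewrite /counit_lift_r counitr.
- move=> c x y; rewrite /counit_lift_r (tlift_is_linear counit_multi_r).
  exact: inj_linear.
- move=> f; rewrite /counit_lift_r tlift_pure // aE eq_sym (negPf ni) scal0.
  rewrite (IH _ i') => [|j]; last by rewrite aE -val_eqE.
  rewrite embed_inj wi /counit_endo.
  rewrite !(linearZf (@inj_linear K B _ _)) inj1.
  by rewrite mulrC -tensor_scaleAl mul1r.
Qed.

Lemma row_starG_delta n (a : nat -> K) i b : (i < n)%N ->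
  (forall j, (j < n)%N -> a j = (j == i)%:R) -> row_starG H n a b = inj i b.
Proof.
move=> lt_in aE; rewrite /row_starG /row_star.
rewrite (@tmap_scal_delta n (fun j => a j) (Ordinal lt_in)) ?embed_inj //.
by move=> j; rewrite aE // -val_eqE.
Qed.

Lemma varE i b : var H i b = inj i b.
Proof.
rewrite /var mact_inj; set M := mtransp K 0 i.
have row0 j : M 0%N j = (j == i)%:R.
  rewrite /M /= /mblock_fun max0n /= ltnS; case: leqP => // lt_ij.
  rewrite (gtn_eqF lt_ij); case: j lt_ij => [|j] //.
have [i0|i0] := eqVneq i 0%N.
  apply: row_starG_delta => [|j _]; last exact: row0.
  by rewrite i0 leq_max orbT.
apply: row_starG_delta => [|j _]; last exact: row0.
rewrite leq_max; apply/orP; left; rewrite ltnNge; apply/negP => le_Mi.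
have := @msizeP _ M 0%N i; rewrite le_Mi orbT row0 eqxx => /(_ isT)/eqP.
by rewrite [0%N == i]eq_sym (negPf i0) oner_eq0.
Qed.

End HierarchyTheory.
Inductive generator (K : fieldType) (B : comAlgType K) :=
| gen_fun of hierarchy B
| gen_sub of imatrix K
| gen_int of nat.

HB.instance Definition _ (K : fieldType) (B : comAlgType K) :=
  gen_eqMixin (generator B).
HB.instance Definition _ (K : fieldType) (B : comAlgType K) :=
  gen_choiceMixin (generator B).

Section PartialIntegralOperators.
Variables (K : fieldType) (B : comAlgType K) (H : scaled_RB_bialgebra B).
Variable S : B -> Prop.
Local Notation G := (hierarchy B).
(* [X i g] is [g(x_i)]. *)
Local Notation X := (var H).

Definition free_alg := {malg K[{fmonom (generator B)}]}.
HB.instance Definition _ := GRing.Lalgebra.on free_alg.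

Definition fgen (x : generator B) : free_alg := << fmu x >>.

Local Notation F g := (fgen (gen_fun g)).
(* This hides the complex conjugation of the library. *)
Local Notation "M ^*" := (fgen (gen_sub B M)) : ring_scope.
Local Notation A i := (fgen (gen_int B i)).
Local Notation L := mL.

(* The relations that define the free product of the algebra [G], the opposite
   monoid algebra of the matrix monoid and the polynomial ring in the [A i] as
   a quotient of the free algebra *)
Inductive free_product_rel : free_alg -> free_alg -> Prop :=
| fun_add g h : free_product_rel (F (g + h)) (F g + F h)
| fun_scale c g : free_product_rel (F (c *: g)) (c *: F g)
| fun_mul g h : free_product_rel (F (g * h)) (F g * F h)
| fun_one : free_product_rel (F 1) 1
| sub_mul M N : free_product_rel (M^* * N^*) (mmul N M)^*
| sub_one : free_product_rel (mid K)^* 1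
| int_comm i j : free_product_rel (A i * A j) (A j * A i).

(* The bounds [_ < n] say that the matrices and vectors that occur fit into
   size [n].  Modulo [free_product_rel] the right hand sides are multilinear in
   the components of the tensor expansion, so that all expansions of an element
   give the same relation. *)
Inductive pio_rel : free_alg -> free_alg -> Prop :=
| rel_sub_fun M g : pio_rel (M^* * F g) (F (mact H M g) * M^*)
| rel_sub_int (M : imatrix K) i : (forall k, M i k = 0) -> pio_rel (M^* * A i) 0
| rel_int_fun_lt i j g : (i < j)%N ->
    pio_rel (A j * F (X i g)) (F (X i g) * A j)
| rel_int_fun_gt i j g : (i < j)%N ->
    pio_rel (A i * F (X j g)) (F (X j g) * A i)
| rel_int_sub n i j (M : imatrix K) g r (c : 'I_r -> nat -> B) :
    (i < n)%N -> (j < n)%N -> supported_below n M ->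
    M i j != 0 -> (forall k, (k < i)%N -> M k j = 0) ->
    let a k := if k == j then 1 else - (M i k / M i j) in
    let l k := M k j / M i j in
    let M' := mmul (L n i (fun k => - l k)) M in
    tensor_expansion H S (iota 0 n) (mact H (mrow n a) (inj 0%N g)) c ->
    pio_rel (A j * F (X j g) * M^*)
      ((M i j)^-1 *: \sum_mu
        F (\prod_(k <- iota 0 n | k != j) X k (c mu k)) * (1 - (mE K j)^*) *
        M'^* * A i *
        F (mact H (mtransp K i j)
            (mact H (mscale j (M i j)^-1) (X j (c mu j)))) *
        (L n i l)^*)
| rel_int_sub0 j (M : imatrix K) g : (forall k, M k j = 0) ->
    pio_rel (A j * F (X j g) * M^*) (F (integ_at H j (X j g)) * M^*)
| rel_int_sort n i j v w g h r (c : 'I_r -> nat -> B) :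
    (i < j)%N -> (j < n)%N ->
    tensor_expansion H S [:: i; j]
      (mact H (mrow n (fun k => vdelta j 1 k - vdelta i (v j) k)) (inj 0%N h))
      c ->
    let v' := mL_apply j (fun k => - w k) v in
    pio_rel
      (A j * F (X j h) * (L n j w)^* * A i * F (X i g) * (L n i v)^*)
      (\sum_mu (1 - (mE K j)^*) * A i * F (X i g * X i (c mu i)) *
         (L n i v')^* * A j * F (X j (c mu j)) * (L n j w)^*)
| rel_int_nested n i k v w g h r (c : 'I_r -> nat -> B) :
    (i < k)%N -> (k < n)%N ->
    w k != 0 -> (forall m, (i < m < k)%N -> w m = 0) ->
    let wbar := vdelta k (w k) in
    let w' m := w m / w k in
    let v' := mL_apply k (fun m => - w' m) v in
    tensor_expansion H S [:: i; k; n]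
      ((w k)^-1 *: mact H
        (mrow n.+1 (fun m => - vdelta i (v k / w k) m + vdelta k (w k)^-1 m
                             - vdelta n (w k)^-1 m)) (inj 0%N h))
      c ->
    pio_rel
      (A i * F (X i h) * (L n i w)^* * A i * F (X i g) * (L n i v)^*)
      (\sum_mu (L n k (fun m => - w' m))^* *
         F (mact H (mtransp K k n) (X n (c mu n))) *
         ((L n i wbar)^* * A i * F (X i g * X i (c mu i)) * (L n i v')^* -
          A i * F (X i g * X i (c mu i)) *
            (L n i (fun m => v' m + wbar m))^*) *
         A k * F (X k (c mu k)) * (L n k w')^*)
| rel_int_RB j g :
    pio_rel (A j * F (X j g) * A j)
      (F (integ_at H j (X j g)) * A j - A j * F (integ_at H j (X j g))).

Definition pio_ideal (z : free_alg) : Prop :=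
  exists l r, (free_product_rel l r \/ pio_rel l r) /\ z = l - r.

(* The algebra [G[\int]] *)
Definition pio := qalg pio_ideal.
HB.instance Definition _ := GRing.PzRing.on pio.
HB.instance Definition _ := GRing.Lmodule.on pio.

Definition pio_fun (g : G) : pio := qalg_proj pio_ideal (F g).
Definition pio_sub (M : imatrix K) : pio := qalg_proj pio_ideal M^*.
Definition pio_int (i : nat) : pio := qalg_proj pio_ideal (A i).

Definition line_integrator (i : nat) (J : pio) : Prop :=
  exists (b : B) (n : nat) (v : nat -> K), [/\ S b, (i < n)%N
    & J = pio_int i * pio_fun (X i b) * pio_sub (mL n i v)].

(* [b M^* J_1 ... J_r]; the sequence [J] lists the pairs [(i_k, J_k)]. *)
Definition normal_term (x : pio) : Prop :=
  exists (b : G) (M : imatrix K) (J : seq (nat * pio)),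
    [/\ tensor_basis S b,
        (forall i t, J = i :: t -> exists k, M i.1 k != 0),
        (forall i, i \in J -> line_integrator i.1 i.2),
        sorted ltn (unzip1 J)
      & x = pio_fun b * pio_sub M * \prod_(i <- J) i.2].

End PartialIntegralOperators.

(* Main.v *)
From HB Require Import structures.
From mathcomp Require Import all_boot all_algebra finmap boolp.
From mathcomp Require Import monalg.
Require Import Defs.

(** Every element is a combination of words in the generators, so it suffices
    that the span of the normal terms contains 1 and is stable under left
    multiplication by functions g, substitutions M and integrals A_j.

    Functions and substitutions cause no trouble: a substitution passes a
    function and is absorbed by the next substitution.  In A_j g(x_j) M only a
    factor L_i(l) of M has to stay on the right of the integral ([int_sub]),
    which leaves a line integrator of index i.  The question is therefore how
    to sort J_0 J_1 ... J_r when J_1, ..., J_r are sorted.  If the index of J_0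
    is the larger one, J_0 and J_1 are exchanged ([line_sort]).  If J_0 and J_1
    have the same index, their product is replaced by products of line
    integrators of distinct indices ([line_nested]), or by a single one
    ([int_RB]).

    Sorting the remaining factors leaves functions and substitutions behind the
    first line integrator, so termination needs an argument. Fix a size n and
    let N_m be the span of the terms g M J_1 ... J_r with sorted indices in [m, n)
    and with M equal to the identity outside the block [m, n); this is
    [normal n m]. Descending induction on m shows that N_m is stable under A_j
    for m <= j < n ([int_closedP]). By the induction hypothesis, everything
    that the rules produce to the right of a line integrator J_m of index m
    lies in N_(m+1), and J_m N_(m+1) is contained in N_m ([normal_line_succ]):
    if M is the identity outside [m+1, n), then column m of M L_m(v) vanishes
    above row m and has the entry 1 there, so that [int_sub] gives back a line
    integrator of index m. The functions g need no such restriction, because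
    A_m commutes with all components of g except the one in x_m, which joins
    the integrand ([normal_int_fun]).

    The rules refer to expansions in the tensor basis over prescribed variables.
    These exist because the coproduct of b, scaled by a row that is supported
    on a set of variables, depends on those variables only
    ([row_starG_depends_on], [tensor_expansionP]). *)

Set Implicit Arguments.
Unset Strict Implicit.
Unset Printing Implicit Defensive.
Import GRing.Theory.
Local Open Scope ring_scope.

(** * Spans *)

Section SpanTheory.
Variables (K : fieldType).
Implicit Types (V W : lmodType K).

Lemma span_linear V W (h : V -> W) (S : V -> Prop) (T : W -> Prop) :
  linear h -> (forall x, S x -> span T (h x)) ->
  forall x, span S x -> span T (h x).
Proof.
move=> hl hS x; elim=> [|{}x /hS //|{}x y _ hx _ hy|c {}x _ hx].
- by rewrite (linear0f hl); apply: span0.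
- by rewrite (linearDf hl); apply: spanD.
- by rewrite (linearZf hl); apply: spanZ.
Qed.

Lemma span_bind V (S T : V -> Prop) x :
  (forall y, S y -> span T y) -> span S x -> span T x.
Proof. by move=> ST; apply: (@span_linear _ _ id). Qed.

Lemma span_mono V (S T : V -> Prop) x :
  (forall y, S y -> T y) -> span S x -> span T x.
Proof. by move=> ST; apply: span_bind => y /ST; apply: span_gen. Qed.

Lemma span_finite V (S : V -> Prop) x : span S x ->
  exists r (c : 'I_r -> K) (t : 'I_r -> V),
    (forall mu, S (t mu)) /\ x = \sum_mu c mu *: t mu.
Proof.
elim=> [|{}x Sx|{}x y _ [r [c [t [tS ->]]]] _ [r' [c' [t' [tS' ->]]]]
       |a {}x _ [r [c [t [tS ->]]]]].
- exists 0%N, (fun=> 0), (fun=> 0); split=> [[]//|]; by rewrite big_ord0.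
- by exists 1%N, (fun=> 1), (fun=> x); rewrite big_ord1 scale1r.
- exists (r + r')%N, (fun mu => match split mu with inl i => c i | inr i => c' i end),
    (fun mu => match split mu with inl i => t i | inr i => t' i end).
  split=> [mu|]; first by case: (split mu).
  rewrite big_split_ord /=; congr (_ + _); apply: eq_bigr => i _.
    by rewrite -[lshift _ _]/(unsplit (inl i)) unsplitK.
  by rewrite -[rshift _ _]/(unsplit (inr i)) unsplitK.
- exists r, (fun mu => a * c mu), t; split=> //.
  by rewrite scaler_sumr; apply: eq_bigr => i _; rewrite scalerA.
Qed.

End SpanTheory.

(** * Tensors that depend on given variables, and their basis expansions *)

Section Tensors.
Variables (K : fieldType) (B : comAlgType K).
Local Notation G := (hierarchy B).
Implicit Types (f : family B nat) (P : nat -> Prop).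

Definition depends_on P : G -> Prop :=
  span (fun x => exists2 f : family B nat, (forall i, ~ P i -> f i = 1) & x = pure f).

Lemma depends_onM P x y :
  depends_on P x -> depends_on P y -> depends_on P (x * y).
Proof.
rewrite /depends_on => hx hy; move: x hx.
apply: (@span_linear _ (tensor B nat) (tensor B nat) (fun x => x * y)).
  by move=> c a b; rewrite mulrDl tensor_scaleAl.
move=> _ [f fP ->]; move: y hy; apply: (@span_linear _ (tensor B nat)
  (tensor B nat) (fun y => pure f * y)).
  by move=> c a b; rewrite mulrDr mulrC -tensor_scaleAl mulrC.
move=> _ [g gP ->]; rewrite pure_mul; apply: span_gen; exists (fam_mul f g) => //.
by move=> i Pi; rewrite fam_mulE fP // gP // mulr1.
Qed.

Lemma depends_on_inj P i b : P i -> depends_on P (inj i b).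
Proof.
move=> Pi; apply: span_gen; exists (upd (fam1 B nat) i b) => // j nPj.
by rewrite updE fam1E; case: eqP nPj => // ->.
Qed.

Lemma depends_on_var (H : scaled_RB_bialgebra B) P i x :
  (forall j, P j -> j = i) -> depends_on P x -> exists b, x = var H i b.
Proof.
move=> Pi; elim=> [|{}x [f fP ->]|{}x y _ [b ->] _ [c ->]|a {}x _ [b ->]].
- by exists 0; rewrite varE (linear0f (@inj_linear _ _ _ i)).
- exists (f i); rewrite varE /inj; congr pure; apply/fsfunP => j.
  by rewrite updE fam1E; case: eqP => [->//|ji]; apply: fP => /Pi.
- by exists (b + c); rewrite !varE (linearDf (@inj_linear _ _ _ i)).
- by exists (a *: b); rewrite !varE (linearZf (@inj_linear _ _ _ i)).
Qed.

Lemma pure_prod_inj (s : seq nat) f : uniq s -> (forall i, i \notin s -> f i = 1) ->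
  pure f = \prod_(i <- s) inj i (f i).
Proof.
move=> us fs; rewrite pureE [RHS](bigID (mem (finsupp f))) /=.
rewrite [X in _ = _ * X]big1 ?mulr1 => [|i hi]; last by rewrite fsfun_dflt ?inj1.
rewrite -[RHS]big_filter; apply: perm_big; apply: uniq_perm.
- exact: fset_uniq.
- exact: filter_uniq.
move=> i; rewrite mem_filter andbC; case: (boolP (i \in s)) => //= /fs fi.
by apply/negbTE; rewrite memNfinsupp fi.
Qed.

(** The factors of a pure tensor are expanded one after the other.  Factors
    equal to 1 are left alone, so that no new variable appears; it is here that
    1 has to be a basis element. *)
Lemma pure_basis (S : B -> Prop) f : (forall b, span S b) -> S 1 ->
  span (fun x => exists g : family B nat,
    [/\ forall i, S (g i), forall i, f i = 1 -> g i = 1 & x = pure g]) (pure f).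
Proof.
move=> Sb S1.
have step (s : seq nat) : uniq s -> {subset s <= finsupp f} ->
    span (fun x => exists g : family B nat,
    [/\ forall i, i \in s -> S (g i), forall i, i \notin s -> g i = f i
      & x = pure g]) (pure f).
  elim: s => [|j s IH] /=; first by move=> _ _; apply: span_gen; exists f.
  move=> /andP [js us] sub; apply: span_bind (IH us _); last first.
    by move=> i si; apply: sub; rewrite inE si orbT.
  move=> _ [g [gS gf ->]].
  have -> : pure g = pure (upd g j (g j)).
    by congr pure; apply/fsfunP => i; rewrite updE; case: eqP => [->|].
  apply: (@span_linear _ _ _ (fun b => pure (upd g j b)) S) (Sb (g j)).
    by have [hD hZ] := @pure_multilinear K B nat; move=> c x y; rewrite hD hZ.
  move=> b Sb'; apply: span_gen; exists (upd g j b); split=> // i.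
    rewrite inE updE; case: eqP => //= _; exact: gS.
  by rewrite inE updE negb_or => /andP [/negPf -> /gf].
apply: span_mono (step _ (fset_uniq (finsupp f)) _) => // _ [g [gS gf ->]].
have gf1 i : f i = 1 -> g i = 1.
  by move=> fi; rewrite gf // memNfinsupp fi.
exists g; split=> // i.
by case: (boolP (i \in finsupp f)) => [/gS//|ni]; rewrite gf // fsfun_dflt.
Qed.

Lemma tensor_expansionP (H : scaled_RB_bialgebra B) (S : B -> Prop) (s : seq nat) x :
  (forall b, span S b) -> S 1 -> uniq s -> s != [::] ->
  depends_on (fun i => i \in s) x ->
  exists r (c : 'I_r -> nat -> B), tensor_expansion H S s x c.
Proof.
move=> Sb S1 us; case Es : s => [|j0 s'] // _; rewrite -Es => hx.
have {hx} /span_finite [r [a [t [tS ->]]]] : span (fun y => exists2 beta : nat -> B,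
    forall j, S (beta j) & y = \prod_(j <- s) inj j (beta j)) x.
  apply: span_bind hx => _ [f fs ->]; apply: span_mono (pure_basis f Sb S1).
  move=> _ [g [gS gf ->]]; exists g => //; apply: pure_prod_inj => // i.
  by move/negP => /fs /gf.
have {tS} tS mu : {beta : nat -> B | (forall j, S (beta j)) &
    t mu = \prod_(j <- s) inj j (beta j)}.
  by apply: cid2; have [beta] := tS mu; exists beta.
pose beta mu := s2val (tS mu).
(* The coefficient of each term goes to the first component. *)
exists r, (fun mu j => if j == j0 then a mu *: beta mu j else beta mu j); split.
  move=> mu; exists j0; first by rewrite Es mem_head.
  by exists (a mu), (beta mu) => j _; split=> //; apply: (s2valP (tS mu)).
apply: eq_bigr => mu _; rewrite [in LHS](s2valP' (tS mu)) -/(beta mu).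
have /andP [j0s' _] : uniq (j0 :: s') by rewrite -Es.
rewrite Es !big_cons !varE eqxx (linearZf (@inj_linear _ _ _ j0)) tensor_scaleAl.
congr (_ * _); apply: eq_big_seq => j js'; rewrite varE.
by case: eqP js' j0s' => // -> ->.
Qed.

(** A zero entry of the row acts on its tensor factor as the counit, whose
    values are scalars. *)
Lemma row_starG_depends_on (H : scaled_RB_bialgebra B) P n (a : nat -> K) b :
  (forall i, (i < n)%N -> a i != 0 -> P i) -> depends_on P (row_starG H n a b).
Proof.
rewrite /row_starG /row_star; elim: n b => [|n IH] b aP /=.
  have hl := tmap_linear (fun i : 'I_0 => linearP (scal H (a i))).
  rewrite (linearZf hl) (linearZf (@embed_linear _ _ _ _ _)).
  rewrite (tmap1 (fun i : 'I_0 => scal H (a i))) embed1; apply: spanZ; apply: span_gen.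
  by exists (fam1 B nat) => // i _; rewrite fam1E.
have hl := tmap_linear (fun i : 'I_n.+1 => linearP (scal H (a i))).
have el := @embed_linear K B _ _ (@nat_of_ord n.+1).
elim/tensor_ind: (comul H b) => [|f|x y hx hy|c x hx].
- rewrite (linear0f (tensl_linear (icomul_linear H n))) (linear0f hl) (linear0f el).
  exact: span0.
- rewrite (tmap_tensl (fun i => scal H (a i)) _ (icomul_linear H n)).
  rewrite embedM colim_compat embed_inj; apply: depends_onM.
    by apply: IH => i lt_in; apply: aP; apply: ltnW.
  have [a0|a0] := eqVneq (a n) 0; last by apply: depends_on_inj; apply: aP.
  rewrite /= a0 scal0 /counit_endo (linearZf (@inj_linear _ _ _ _)) inj1.
  apply: spanZ; apply: span_gen; exists (fam1 B nat) => // i _.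
  by rewrite fam1E.
- rewrite (linearDf (tensl_linear (icomul_linear H n))) (linearDf hl) (linearDf el).
  exact: spanD.
- rewrite (linearZf (tensl_linear (icomul_linear H n))) (linearZf hl) (linearZf el).
  exact: spanZ.
Qed.

Lemma mact_inj_depends_on (H : scaled_RB_bialgebra B) P (M : imatrix K) i b :
  (forall k, M i k != 0 -> P k) -> depends_on P (mact H M (inj i b)).
Proof.
by move=> MP; rewrite mact_inj; apply: row_starG_depends_on => k _; apply: MP.
Qed.

Lemma mact_inj_var (H : scaled_RB_bialgebra B) (M : imatrix K) i j b :
  (forall k, M i k != 0 -> k = j) -> exists b', mact H M (inj i b) = var H j b'.
Proof. by move=> Mij; apply: depends_on_var (mact_inj_depends_on H b Mij). Qed.

End Tensors.

(** * Matrices that are the identity outside a diagonal block *)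

Section MatrixSupport.
Variable K : fieldType.
Implicit Types (M N : imatrix K).

Definition supported_in m n M : Prop := forall i j,
  ~~ [&& (m <= i)%N, (i < n)%N, (m <= j)%N & (j < n)%N] -> M i j = (i == j)%:R.

Lemma supported_in_below m n M : supported_in m n M -> supported_below n M.
Proof.
move=> hM i j h; apply: hM; apply: contraL h => /and4P [_ lt_in _ lt_jn].
by rewrite negb_or -!ltnNge lt_in.
Qed.

Lemma supported_below_in n M : supported_below n M -> supported_in 0 n M.
Proof. by move=> hM i j; rewrite !leq0n /= negb_and -!leqNgt; apply: hM. Qed.

Lemma supported_in_mono m m' n M :
  (m <= m')%N -> supported_in m' n M -> supported_in m n M.
Proof.
move=> le_mm hM i j h; apply: hM; apply: contra h => /and4P [mi -> mj ->].
by rewrite !(leq_trans le_mm).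
Qed.

Lemma sum_mul_supported p q M N i j : supported_below p M -> supported_below p N ->
  (p <= q)%N -> (i < q)%N -> (j < q)%N ->
  \sum_(k < q) M i k * N k j =
  mblock_fun p (fun i j => \sum_(k < p) M i k * N k j) i j.
Proof.
move=> hM hN le_pq lt_iq lt_jq; rewrite /mblock_fun.
case: (ltnP i p) => [lt_ip|le_pi] /=; last first.
  rewrite (bigD1 (Ordinal lt_iq)) //= hM ?le_pi // eqxx mul1r big1 ?addr0 => [|k].
    by rewrite hN ?le_pi.
  by rewrite -val_eqE /= eq_sym => /negPf ki; rewrite hM ?le_pi // ki mul0r.
case: ltnP => [lt_jp|le_pj].
  rewrite (big_ord_widen q (fun k => M i k * N k j) le_pq) [RHS]big_mkcond /=.
  apply: eq_bigr => k _; case: ltnP => // le_pk.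
  by rewrite hM ?le_pk ?orbT // ltn_eqF ?mul0r // (leq_trans lt_ip).
rewrite (bigD1 (Ordinal lt_jq)) //= hN ?le_pj ?orbT // eqxx mulr1 big1 ?addr0 => [|k].
  by rewrite hM ?le_pj ?orbT.
by rewrite -val_eqE /= => /negPf kj; rewrite hN ?le_pj ?orbT // kj mulr0.
Qed.

(** The size used by [mmul] is an unspecified one; any size that fits both
    factors gives the same product. *)
Lemma mmulE n M N i j : supported_below n M -> supported_below n N ->
  mmul M N i j = mblock_fun n (fun i j => \sum_(k < n) M i k * N k j) i j.
Proof.
move=> hM hN; rewrite /mmul /=; set n0 := maxn _ _.
have hM0 : supported_below n0 M.
  move=> r s h; apply: msizeP; case/orP: h; rewrite geq_max => /andP [-> _];
  by rewrite ?orbT.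
have hN0 : supported_below n0 N.
  move=> r s h; apply: msizeP; case/orP: h; rewrite geq_max => /andP [_ ->];
  by rewrite ?orbT.
pose q := maxn n (maxn n0 (maxn i j).+1).
have [le_iq le_jq] : (i < q)%N /\ (j < q)%N.
  by rewrite /q !leq_max !ltnS !leq_max !leqnn !orbT.
have le_nq : (n <= q)%N by rewrite leq_maxl.
have le_n0q : (n0 <= q)%N by rewrite (leq_trans (leq_maxl _ (maxn i j).+1)) ?leq_maxr.
by rewrite -(sum_mul_supported hM0 hN0 le_n0q) // (sum_mul_supported hM hN le_nq).
Qed.

Lemma mmul_supported_in m n M N :
  supported_in m n M -> supported_in m n N -> supported_in m n (mmul M N).
Proof.
move=> hM hN i j h.
rewrite (mmulE _ _ (supported_in_below hM) (supported_in_below hN)) /mblock_fun.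
case: ltnP => //= lt_in; case: ltnP => //= lt_jn.
move: h; rewrite lt_in lt_jn /= andbT negb_and -!ltnNge => /orP [lt_im|lt_jm].
  rewrite (bigD1 (Ordinal lt_in)) //= [M i i]hM ?eqxx ?mul1r; last first.
    by rewrite leqNgt lt_im.
  rewrite hN; last by rewrite leqNgt lt_im.
  rewrite big1 ?addr0 // => k; rewrite -val_eqE /= eq_sym => /negPf ki.
  by rewrite hM ?ki ?mul0r // leqNgt lt_im.
rewrite (bigD1 (Ordinal lt_jn)) //= [N j j]hN ?eqxx ?mulr1; last first.
  by rewrite [(m <= j)%N]leqNgt lt_jm /= ?andbF.
rewrite hM; last by rewrite [(m <= j)%N]leqNgt lt_jm /= ?andbF.
rewrite big1 ?addr0 // => k; rewrite -val_eqE /= => /negPf kj.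
by rewrite hN ?kj ?mulr0 // [(m <= j)%N]leqNgt lt_jm /= ?andbF.
Qed.

Lemma mL_supported_in m n i w : (m <= i)%N -> supported_in m n (mL n i w : imatrix K).
Proof.
move=> le_mi r s h; rewrite /mL /= /mblock_fun.
case: ltnP => //= lt_rn; case: ltnP => //= lt_sn.
case: ltnP => //= lt_ir; last by rewrite mulr0n addr0.
case: (s =P i) => [Es|_]; last by rewrite mulr0n addr0.
by move: h; rewrite lt_rn lt_sn Es le_mi (leq_trans le_mi (ltnW lt_ir)).
Qed.

Lemma mE_supported_in m n j : (m <= j < n)%N -> supported_in m n (mE K j).
Proof.
case/andP=> le_mj lt_jn r s h; rewrite /mE /= /mblock_fun.
case: ifP => // _; case: (r =P j) => [Er|_] /=; last by rewrite subr0.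
case: (s =P j) => [Es|_]; last by rewrite subr0.
by move: h; rewrite Er Es le_mj lt_jn.
Qed.

Lemma mL0 n i (w : nat -> K) : (forall k, (i < k < n)%N -> w k = 0) ->
  mL n i w = mid K.
Proof.
move=> w0; apply: imatrixP => r s; rewrite /mL /mid /= /mblock_fun /=.
case: ltnP => //= lt_rn; case: ltnP => //= lt_sn.
by case: ltnP => [lt_ir|_] /=; rewrite ?addr0 // w0 ?lt_ir // mul0rn addr0.
Qed.

(** Composing with a matrix that only acts on the variables beyond m keeps
    the pivot of L_m(v) at row m. *)
Lemma mmul_mL_col m n M v : (m < n)%N -> supported_in m.+1 n M ->
  mmul M (mL n m v) m m = 1 /\ forall k, (k < m)%N -> mmul M (mL n m v) k m = 0.
Proof.
move=> lt_mn hM; have hL := @mL_supported_in m n m v (leqnn m).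
have col k : (k <= m)%N -> mmul M (mL n m v) k m = (k == m)%:R.
  move=> le_km; have lt_kn := leq_ltn_trans le_km lt_mn.
  have notin j : ~~ [&& (m.+1 <= k)%N, (k < n)%N, (m.+1 <= j)%N & (j < n)%N].
    by rewrite ltnNge le_km.
  rewrite (mmulE _ _ (supported_in_below hM) (supported_in_below hL)).
  rewrite /mblock_fun lt_kn lt_mn /= (bigD1 (Ordinal lt_kn)) //= /mblock_fun.
  rewrite lt_kn lt_mn (ltnNge m k) le_km /= mulr0n addr0.
  rewrite big1 ?addr0 => [|j]; first by rewrite hM // eqxx mul1r.
  by rewrite -val_eqE /= eq_sym => /negPf kj; rewrite hM // kj mul0r.
by split=> [|k lt_km]; rewrite col ?eqxx ?(ltn_eqF lt_km) // ltnW.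
Qed.

End MatrixSupport.

(** * The relations of the algebra *)

(** The quotient map and the images of the generators are locked, because
    unification would otherwise compare the elements of the quotient by
    unfolding them down to the free algebra. *)
HB.lock Definition pclass (K : fieldType) (B : comAlgType K)
  (H : scaled_RB_bialgebra B) (S : B -> Prop) (p : free_alg B) : pio H S :=
  qalg_proj (@pio_ideal K B H S) p.

HB.lock Definition op_fun (K : fieldType) (B : comAlgType K)
  (H : scaled_RB_bialgebra B) (S : B -> Prop) (g : hierarchy B) : pio H S :=
  pclass H S (fgen (gen_fun g)).

HB.lock Definition op_sub (K : fieldType) (B : comAlgType K)
  (H : scaled_RB_bialgebra B) (S : B -> Prop) (M : imatrix K) : pio H S :=
  pclass H S (fgen (gen_sub B M)).

HB.lock Definition op_int (K : fieldType) (B : comAlgType K)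
  (H : scaled_RB_bialgebra B) (S : B -> Prop) (i : nat) : pio H S :=
  pclass H S (fgen (gen_int B i)).

(** A line integrator with an arbitrary integrand instead of a basis element,
    hence linear in b *)
HB.lock Definition line (K : fieldType) (B : comAlgType K)
  (H : scaled_RB_bialgebra B) (S : B -> Prop) (n i : nat) (b : B) (v : nat -> K) :
  pio H S := op_int H S i * op_fun H S (var H i b) * op_sub H S (mL n i v).

(** The shape of the terms in [rel_int_nested], for abstract rings: here the
    rewriting does not look into the quotient of the free algebra. *)
Lemma morph_nested (A R : pzRingType) (f : A -> R) :
  {morph f : x y / x * y} -> {morph f : x y / x - y} ->
  forall a0 a1 a2 a3 a4 a5 a6 a7 a8 a9,
  f (a0 * a1 * (a2 * a3 * a4 * a5 - a3 * a4 * a6) * a7 * a8 * a9) =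
  f a0 * f a1 * (f a2 * (f a3 * f a4 * f a5) - f a3 * f a4 * f a6) *
  (f a7 * f a8 * f a9).
Proof. by move=> fM fB *; rewrite !(fM, fB) !mulrA. Qed.

Section Operators.
Variables (K : fieldType) (B : comAlgType K) (H : scaled_RB_bialgebra B).
Variable S : B -> Prop.
Local Notation G := (hierarchy B).
Local Notation R := (pio H S).
Local Notation X := (var H).
Local Notation cls := (@pclass K B H S).
Local Notation F := (op_fun H S).
Local Notation Sub := (op_sub H S).
Local Notation A := (op_int H S).
Local Notation line := (@line K B H S).
Implicit Types (x y z : R) (g h : G) (M N : imatrix K) (b : B).

Lemma scalerAr_central (A' : lalgType K) (c : K) (p q : A') :
  p * c%:A = c%:A * p -> p * (c *: q) = c *: (p * q).
Proof. by move=> cp; rewrite -[q in LHS]mul1r scalerAl mulrA cp -!scalerAl mul1r. Qed.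

(** Scalars are multiples of the empty word, which commutes with all words. *)
Lemma malg_scalerAr (c : K) (p q : free_alg B) : p * (c *: q) = c *: (p * q).
Proof.
apply: scalerAr_central; rewrite -malgUZ [LHS]fgmulgU [RHS]fgmulUg.
by apply: eq_bigr => k _; rewrite mulrC mulm1 mul1m.
Qed.

Lemma pclassM p q : cls (p * q) = cls p * cls q.
Proof. rewrite pclass.unlock; exact: (rmorphM (qalg_proj (@pio_ideal K B H S))). Qed.

Lemma pclassZ c p : cls (c *: p) = c *: cls p.
Proof.
rewrite pclass.unlock; exact: (@linearZ_LR _ _ _ _ (qalg_proj (@pio_ideal K B H S))).
Qed.

Lemma pclassD p q : cls (p + q) = cls p + cls q.
Proof.
rewrite pclass.unlock; exact: (@linearD _ _ _ _ (qalg_proj (@pio_ideal K B H S))).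
Qed.

Lemma pclassB p q : cls (p - q) = cls p - cls q.
Proof.
rewrite pclass.unlock; exact: (@linearB _ _ _ _ (qalg_proj (@pio_ideal K B H S))).
Qed.

Lemma pclass1 : cls 1 = 1.
Proof. rewrite pclass.unlock; exact: (rmorph1 (qalg_proj (@pio_ideal K B H S))). Qed.

Lemma pclass0 : cls 0 = 0.
Proof.
rewrite pclass.unlock; exact: (@linear0 _ _ _ _ (qalg_proj (@pio_ideal K B H S))).
Qed.

Lemma pclass_sum n (p : 'I_n -> free_alg B) : cls (\sum_i p i) = \sum_i cls (p i).
Proof. exact: (big_morph cls pclassD pclass0). Qed.

Lemma pclass_surj x : exists p, x = cls p.
Proof. rewrite pclass.unlock; exact: qalg_projP. Qed.

Lemma pclass_rel l r : free_product_rel l r \/ pio_rel H S l r -> cls l = cls r.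
Proof.
move=> rel; apply/eqP; rewrite -subr_eq0 -pclassB pclass.unlock; apply/eqP.
by apply: qalg_projE; exists l, r.
Qed.

Lemma pclass_fun g : F g = cls (fgen (gen_fun g)).
Proof. by rewrite op_fun.unlock. Qed.

Lemma pclass_sub M : Sub M = cls (fgen (gen_sub B M)).
Proof. by rewrite op_sub.unlock. Qed.

Lemma pclass_int i : A i = cls (fgen (gen_int B i)).
Proof. by rewrite op_int.unlock. Qed.

Definition opE := (pclass_fun, pclass_sub, pclass_int).

Lemma pclass_oneB p : cls (1 - p) = 1 - cls p.
Proof. by rewrite pclassB pclass1. Qed.

Lemma pio_scalerAr (c : K) x y : x * (c *: y) = c *: (x * y).
Proof.
have [[p ->] [q ->]] := (pclass_surj x, pclass_surj y).
by rewrite -pclassZ -!pclassM malg_scalerAr pclassZ.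
Qed.

Lemma pio_scalerAl (c : K) x y : (c *: x) * y = c *: (x * y).
Proof.
have [[p ->] [q ->]] := (pclass_surj x, pclass_surj y).
by rewrite -pclassZ -!pclassM -scalerAl pclassZ.
Qed.

Lemma mull_linear z : linear (fun x => z * x).
Proof. by move=> c x y; rewrite mulrDr pio_scalerAr. Qed.

Lemma mulr_linear z : linear (fun x => x * z).
Proof. by move=> c x y; rewrite mulrDl pio_scalerAl. Qed.

Lemma funD g h : F (g + h) = F g + F h.
Proof. by rewrite !opE -pclassD; apply: pclass_rel; left; apply: fun_add. Qed.

Lemma funZ c g : F (c *: g) = c *: F g.
Proof. by rewrite !opE -pclassZ; apply: pclass_rel; left; apply: fun_scale. Qed.

Lemma funM g h : F (g * h) = F g * F h.
Proof. by rewrite !opE -pclassM; apply: pclass_rel; left; apply: fun_mul. Qed.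

Lemma fun1 : F 1 = 1.
Proof. by rewrite !opE -pclass1; apply: pclass_rel; left; apply: fun_one. Qed.

Lemma subM M N : Sub M * Sub N = Sub (mmul N M).
Proof. by rewrite !opE -pclassM; apply: pclass_rel; left; apply: sub_mul. Qed.

Lemma sub1 : Sub (mid K) = 1.
Proof. by rewrite !opE -pclass1; apply: pclass_rel; left; apply: sub_one. Qed.

Lemma sub_fun M g : Sub M * F g = F (mact H M g) * Sub M.
Proof. by rewrite !opE -!pclassM; apply: pclass_rel; right; apply: rel_sub_fun. Qed.

Lemma sub_int M i : (forall k, M i k = 0) -> Sub M * A i = 0.
Proof.
move=> M0; rewrite !opE -pclassM -pclass0.
by apply: pclass_rel; right; apply: rel_sub_int.
Qed.

Lemma int_fun_neq i j b : i != j -> A i * F (X j b) = F (X j b) * A i.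
Proof.
rewrite neq_ltn => /orP [lt_ij|lt_ji]; rewrite !opE -!pclassM; apply: pclass_rel; right.
  exact: rel_int_fun_gt.
exact: rel_int_fun_lt.
Qed.

Lemma int_sub0 j M b : (forall k, M k j = 0) ->
  A j * F (X j b) * Sub M = F (X j (integ H b)) * Sub M.
Proof.
move=> M0; rewrite [X j (_ b)]varE -integ_at_inj -(varE H) !opE -!pclassM.
by apply: pclass_rel; right; apply: rel_int_sub0.
Qed.

Lemma int_RB j b : A j * F (X j b) * A j =
  F (X j (integ H b)) * A j - A j * F (X j (integ H b)).
Proof.
rewrite [X j (_ b)]varE -integ_at_inj -(varE H) !opE -!pclassM -pclassB.
by apply: pclass_rel; right; apply: rel_int_RB.
Qed.

Hypotheses (S_basis : forall b, span S b) (S_one : S 1).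

(** The pivot of column j of M lies in row i.  Splitting off L_i(l), which
    carries the entries of that column below the pivot, is what turns A_j into
    a line integrator of index i. *)
Lemma int_sub n i j M b : (i < n)%N -> (j < n)%N -> supported_below n M ->
  M i j != 0 -> (forall k, (k < i)%N -> M k j = 0) ->
  span (fun x => exists g b' v, x = F g * (1 - Sub (mE K j)) *
     Sub (mmul (mL n i (fun k => - (M k j / M i j))) M) * line n i b' v)
    (A j * F (X j b) * Sub M).
Proof.
move=> lt_in lt_jn hM Mij M0.
pose a k := if k == j then 1 else - (M i k / M i j).
have n_gt0 : (0 < n)%N by apply: leq_ltn_trans lt_in.
have [||r [c hc]] := @tensor_expansionP _ _ H S (iota 0 n)
    (mact H (mrow n a) (inj 0%N b)) S_basis S_one (iota_uniq 0 n).
- by case: (n) n_gt0.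
- apply: mact_inj_depends_on => k; rewrite mem_iota add0n /= /mblock_fun n_gt0 /=.
  by case: ltnP => // le_nk; rewrite ltn_eqF ?eqxx // (leq_trans n_gt0).
rewrite !opE -!pclassM.
rewrite (pclass_rel (or_intror
  (@rel_int_sub K B H S n i j M b r c lt_in lt_jn hM Mij M0 hc))).
rewrite pclassZ pclass_sum; apply: spanZ; apply: span_sum => mu _.
have [b1 E1] : exists b1, mact H (mscale j (M i j)^-1) (X j (c mu j)) = X j b1.
  rewrite varE; apply: mact_inj_var => k.
  rewrite /= /mblock_fun; case: ifP => _; last by case: (j =P k) => // _; rewrite eqxx.
  have [//|kj] := eqVneq k j.
  by rewrite andbF mulr0n addr0 eqxx.
have [b2 E2] : exists b2, mact H (mtransp K i j) (X j b1) = X i b2.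
  rewrite varE; apply: mact_inj_var => k.
  rewrite /= /mblock_fun ltnS leq_maxr /= eqxx.
  have -> : (if j == i then j else i) = i by case: (j =P i).
  case: (k =P i) => [//|/eqP ki]; case: ifP => lek; first by rewrite eqxx.
  case: (j =P k) => [jk|_]; last by rewrite eqxx.
  by rewrite -jk ltnS leq_maxr in lek.
rewrite E1 E2; apply: span_gen.
exists (\prod_(k <- iota 0 n | k != j) X k (c mu k)), b2, (fun k => M k j / M i j).
by rewrite line.unlock !opE !mulrA -pclass_oneB -!pclassM.
Qed.

(** Integrals over different variables are exchanged at the cost of a linear
    change of variables in the integrand and of an evaluation at x_j = 0. *)
Lemma line_sort n i j b b' w v : (i < j)%N -> (j < n)%N ->
  span (fun x => exists c v' c', x = (1 - Sub (mE K j)) * line n i c v' * line n j c' w)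
    (line n j b w * line n i b' v).
Proof.
move=> lt_ij lt_jn.
have n_gt0 : (0 < n)%N by apply: leq_ltn_trans lt_jn.
have [|||r [c hc]] := @tensor_expansionP _ _ H S [:: i; j] (mact H (mrow n
    (fun k => vdelta j 1 k - vdelta i (v j) k)) (inj 0%N b)) S_basis S_one.
- by rewrite /= inE ltn_eqF.
- by [].
- apply: mact_inj_depends_on => k; rewrite /= /mblock_fun n_gt0 /=.
  case: ltnP => [_|le_nk]; last by rewrite ltn_eqF ?eqxx // (leq_trans n_gt0).
  rewrite !inE /vdelta; case: (k == i) => //; case: (k == j) => //.
  by rewrite !mulr0n subr0 eqxx.
have := pclass_rel (or_intror
  (@rel_int_sort K B H S n i j v w b' b r c lt_ij lt_jn hc)).
rewrite line.unlock !mulrA !opE -!pclassM => ->; rewrite pclass_sum.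
apply: span_sum => mu _; apply: span_gen.
exists (b' * c mu i), (mL_apply j (fun k => - w k) v), (c mu j).
rewrite [X i (_ * _)](varE H) injM -!(varE H).
by rewrite !opE !mulrA -pclass_oneB -!pclassM.
Qed.

(** Between the two integrals over x_i, each x_m with m > i is shifted by
    w_m x_i.  If x_k is the first variable that really moves, one of the two
    integrations can be carried out along x_k instead, so that the result
    consists of pairs of an integral over x_i and an integral over x_k. *)
Lemma line_nested n i k b b' w v : (i < k)%N -> (k < n)%N ->
  w k != 0 -> (forall m, (i < m < k)%N -> w m = 0) ->
  span (fun x => exists u g u' c v' v'' c' w',
      x = Sub (mL n k u) * F g *
          (Sub (mL n i u') * line n i c v' - line n i c v'') * line n k c' w')
    (line n i b w * line n i b' v).
Proof.
move=> lt_ik lt_kn wk w0; have lt_in := ltn_trans lt_ik lt_kn.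
have [|||r [c hc]] := @tensor_expansionP _ _ H S [:: i; k; n]
    ((w k)^-1 *: mact H (mrow n.+1 (fun m => - vdelta i (v k / w k) m
       + vdelta k (w k)^-1 m - vdelta n (w k)^-1 m)) (inj 0%N b)) S_basis S_one.
- by rewrite /= !inE negb_or !ltn_eqF.
- by [].
- apply: spanZ; apply: mact_inj_depends_on => m; rewrite /= /mblock_fun /=.
  case: ltnP => [_|lt_nm]; last by rewrite ltn_eqF ?eqxx // (leq_trans _ lt_nm).
  rewrite !inE /vdelta; case: (m == i) => //; case: (m == k) => //.
  by case: (m == n) => //; rewrite !mulr0n oppr0 !addr0 eqxx.
have := pclass_rel (or_intror
  (@rel_int_nested K B H S n i k v w b' b r c lt_ik lt_kn wk w0 hc)).
rewrite line.unlock !mulrA !opE -!pclassM => ->; rewrite pclass_sum.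
apply: span_sum => mu _; apply: span_gen.
exists (fun m => - (w m / w k)), (mact H (mtransp K k n) (X n (c mu n))),
  (vdelta k (w k)), (b' * c mu i), (mL_apply k (fun m => - (w m / w k)) v),
  (fun m => mL_apply k (fun m => - (w m / w k)) v m + vdelta k (w k) m),
  (c mu k), (fun m => w m / w k).
rewrite [X i (_ * _)](varE H) injM -!(varE H).
by rewrite (morph_nested pclassM pclassB) !opE.
Qed.

(** * Normal forms of bounded size *)

Inductive ordered_product n : nat -> R -> Prop :=
| ordered_product1 m : ordered_product n m 1
| ordered_product_line m i b v y : (m <= i)%N -> (i < n)%N -> S b ->
    ordered_product n i.+1 y -> ordered_product n m (line n i b v * y).

(** The analogue of the normal terms inside the block [m, n).  The function g
    may involve all variables, and the row conditions on M are imposed only at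
    the end, in [normal_term_normal]. *)
Definition normal n m : R -> Prop := span (fun x => exists g M y,
  [/\ supported_in m n M, ordered_product n m y & x = F g * Sub M * y]).

Lemma ordered_product_mono n m m' y :
  (m <= m')%N -> ordered_product n m' y -> ordered_product n m y.
Proof.
move=> le_mm oy; case: oy le_mm => [m0|m0 i b v z le_mi lt_in Sb oz] le_mm.
  exact: ordered_product1.
by apply: ordered_product_line => //; apply: leq_trans le_mi.
Qed.

Lemma normal_mono n m m' x : (m <= m')%N -> normal n m' x -> normal n m x.
Proof.
move=> le_mm; apply: span_mono => _ [g [M [y [hM oy ->]]]]; exists g, M, y.
by split=> //; [apply: supported_in_mono hM | apply: ordered_product_mono oy].
Qed.

Lemma normal_fun n m g x : normal n m x -> normal n m (F g * x).
Proof.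
apply: (span_linear (mull_linear (F g))) => _ [h [M [y [hM oy ->]]]].
by apply: span_gen; exists (g * h), M, y; rewrite funM !mulrA.
Qed.

Lemma normal_sub n m M x :
  supported_in m n M -> normal n m x -> normal n m (Sub M * x).
Proof.
move=> hM; apply: (span_linear (mull_linear (Sub M))) => _ [g [N [y [hN oy ->]]]].
apply: span_gen; exists (mact H M g), (mmul N M), y; split=> //.
  exact: mmul_supported_in.
by rewrite -subM !mulrA sub_fun.
Qed.

Lemma normal_ordered n m y : ordered_product n m y -> normal n m y.
Proof.
move=> oy; apply: span_gen; exists 1, (mid K), y; split=> //.
by rewrite fun1 sub1 !mul1r.
Qed.

Lemma line_linear n i v z : linear (fun b => line n i b v * z).
Proof.
move=> c b b'; rewrite line.unlock [X i (_ + _)](varE H) (@inj_linear K B _ i).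
rewrite -!(varE H).
by rewrite funD funZ mulrDr !mulrDl pio_scalerAr !pio_scalerAl.
Qed.

Lemma normal_line n m i b v y : (m <= i)%N -> (i < n)%N ->
  ordered_product n i.+1 y -> normal n m (line n i b v * y).
Proof.
move=> le_mi lt_in oy; apply: (span_linear (line_linear n i v y)) (S_basis b) => b' Sb.
by apply: normal_ordered; apply: ordered_product_line.
Qed.

Lemma normal_oneB_sub n m M x :
  supported_in m n M -> normal n m x -> normal n m ((1 - Sub M) * x).
Proof.
move=> hM nx; rewrite mulrBl mul1r; apply: spanD => //; apply: spanN.
exact: normal_sub.
Qed.

(** In each pure tensor, the factors in the variables other than x_j commute
    with A_j and leave to the left. *)
Lemma normal_int_fun n m j g z : (forall b, normal n m (A j * F (X j b) * z)) ->
  normal n m (A j * F g * z).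
Proof.
move=> hz; elim/tensor_ind: g => [|f|g h hg hh|c g hg].
- have -> : F 0 = 0 by rewrite -(scale0r (1 : G)) funZ scale0r.
  by rewrite mulr0 mul0r; apply: span0.
- pose s := [seq i <- finsupp f | i != j]; pose p := \prod_(i <- s) inj i (f i).
  have -> : pure f = p * X j (f j).
    rewrite (varE H) (@pure_prod_inj _ _ (j :: s)) ?big_cons 1?mulrC //=.
      by rewrite mem_filter eqxx filter_uniq ?fset_uniq.
    move=> i; rewrite inE negb_or mem_filter => /andP [-> /=].
    by rewrite memNfinsupp => /eqP.
  have Ap : A j * F p = F p * A j.
    rewrite /p big_seq; apply: (big_ind (fun p => A j * F p = F p * A j)).
    - by rewrite fun1 mulr1 mul1r.
    - by move=> u v hu hv; rewrite funM mulrA hu -mulrA hv mulrA.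
    - move=> i; rewrite mem_filter eq_sym -(varE H) => /andP [ji _].
      exact: int_fun_neq.
  by rewrite funM mulrA Ap -!mulrA; apply: normal_fun; rewrite mulrA; apply: hz.
- by rewrite funD mulrDr mulrDl; apply: spanD.
- by rewrite funZ pio_scalerAr pio_scalerAl; apply: spanZ.
Qed.

(** The substitution of a line integrator of index m merges with that of the
    term to its right.  By [mmul_mL_col] the pivot of column m of the product
    is still in row m, so pulling the product out to the left by [int_sub]
    leaves an integral over x_m in front of indices that exceed m. *)
Lemma normal_line_succ n m b v x : (m < n)%N ->
  normal n m.+1 x -> normal n m (line n m b v * x).
Proof.
move=> lt_mn; apply: (span_linear (mull_linear (line n m b v))).
move=> _ [g [M [y [hM oy ->]]]].
have -> : line n m b v * (F g * Sub M * y) =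
    A m * F (X m b * mact H (mL n m v) g) * (Sub (mmul M (mL n m v)) * y).
  by rewrite line.unlock funM -subM !mulrA -[_ * Sub _ * F g]mulrA sub_fun !mulrA.
apply: normal_int_fun => b'; rewrite mulrA.
have hML : supported_in m n (mmul M (mL n m v)).
  by apply: mmul_supported_in; [apply: supported_in_mono hM | apply: mL_supported_in].
have [Mmm M0] := mmul_mL_col v lt_mn hM.
have Mmm' : mmul M (mL n m v) m m != 0 by rewrite Mmm oner_eq0.
apply: (span_linear (mulr_linear y)) (int_sub b' lt_mn lt_mn
  (supported_in_below hML) Mmm' M0) => _ [h [b1 [w ->]]].
rewrite -!mulrA; apply: normal_fun; apply: normal_oneB_sub.
  by apply: mE_supported_in; rewrite leqnn.
apply: normal_sub; last exact: normal_line.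
by apply: mmul_supported_in => //; apply: mL_supported_in.
Qed.

Definition int_closed n m := forall j x, (m <= j)%N -> (j < n)%N ->
  normal n m x -> normal n m (A j * x).

Lemma line_closed n m i b w x : int_closed n m -> (m <= i)%N -> (i < n)%N ->
  normal n m x -> normal n m (line n i b w * x).
Proof.
move=> cl le_mi lt_in nx; rewrite line.unlock -!mulrA; apply: cl => //.
by apply: normal_fun; apply: normal_sub nx; apply: mL_supported_in.
Qed.

(** One step of insertion sort.  Whatever the exchange rules leave to the
    right of the line integrator of index m belongs to [normal n m.+1], where
    the induction hypothesis [int_closed n m.+1] applies. *)
Lemma normal_line_ordered n m i b w y : int_closed n m.+1 -> (m <= i)%N -> (i < n)%N ->
  ordered_product n m y -> normal n m (line n i b w * y).
Proof.
move=> cl le_mi lt_in oy.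
case: oy (oy) le_mi => {m y} [m|m i1 b1 v y le_mi1 lt_i1n Sb1 oy] oy0 le_mi in cl *.
  by apply: normal_line => //; apply: ordered_product1.
have [lt_ii1|le_i1i] := ltnP i i1.
  by apply: normal_line => //; apply: ordered_product_line.
have [lt_mi1|le_i1m] := ltnP m i1.
  apply: (@normal_mono n m m.+1) => //; apply: line_closed => //.
    exact: leq_trans le_i1i.
  by apply: normal_ordered; apply: ordered_product_line.
have Ei1 : i1 = m by apply/eqP; rewrite eqn_leq le_i1m.
rewrite {i1 le_mi1 lt_i1n oy0 le_i1i le_i1m}Ei1 in oy *; rewrite mulrA.
move: le_mi; rewrite leq_eqVlt => /predU1P [Emi|lt_mi]; last first.
  apply: (span_linear (mulr_linear y)) (line_sort b b1 w v lt_mi lt_in).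
  move=> _ [c [v' [c' ->]]]; rewrite -!mulrA; apply: normal_oneB_sub.
    by apply: mE_supported_in; rewrite ltnW.
  apply: normal_line_succ; first exact: ltn_trans lt_in.
  by apply: line_closed => //; apply: normal_ordered.
rewrite -{i}Emi {Emi} in lt_in *.
(* Both line integrators now have index m. *)
case: (pickP (fun k : 'I_n => (m < k)%N && (w k != 0))) => [k0 hk0|w0].
  have ex_k : exists k, (m < k < n)%N && (w k != 0).
    by exists k0; rewrite ltn_ord andbT.
  case: (ex_minnP ex_k) => k /andP [/andP [lt_mk lt_kn] wk] k_min.
  have w0 k' : (m < k' < k)%N -> w k' = 0.
    case/andP=> lt_mk' lt_k'k; have [//|wk'] := eqVneq (w k') 0.
    have := k_min k'; rewrite lt_mk' wk' (ltn_trans lt_k'k lt_kn) leqNgt lt_k'k.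
    by move/(_ isT).
  apply: (span_linear (mulr_linear y)) (line_nested b b1 v lt_mk lt_kn wk w0).
  move=> _ [u [g [u' [c [v' [v'' [c' [w' ->]]]]]]]].
  have nk : normal n m.+1 (line n k c' w' * y).
    by apply: line_closed => //; apply: normal_ordered.
  rewrite -!mulrA; apply: normal_sub.
    by apply: mL_supported_in; apply: ltnW.
  apply: normal_fun; rewrite mulrBl; apply: spanD; last apply: spanN.
    rewrite -mulrA; apply: normal_sub; first exact: mL_supported_in.
    exact: normal_line_succ.
  exact: normal_line_succ.
(* L_m(w) is the identity, so the Rota-Baxter rule applies. *)
have -> : line n m b w = A m * F (X m b).
  rewrite line.unlock mL0 ?sub1 ?mulr1 // => k /andP [lt_mk lt_kn].
  by have := w0 (Ordinal lt_kn); rewrite /= lt_mk => /negbFE/eqP.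
have -> : A m * F (X m b) * line n m b1 v * y =
    F (X m (integ H b)) * (line n m b1 v * y) - line n m (integ H b * b1) v * y.
  rewrite line.unlock [X m (integ H b * _)](varE H) injM -!(varE H) funM !mulrA.
  by rewrite int_RB !mulrBl.
apply: spanD; first by apply: normal_fun; apply: normal_line.
by apply: spanN; apply: normal_line.
Qed.

Lemma int_closedP n m : (m <= n)%N -> int_closed n m.
Proof.
move=> le_mn; have [d Ed] : exists d, (n - m = d)%N by exists (n - m)%N.
elim: d m le_mn Ed => [|d IH] m le_mn Ed j x le_mj lt_jn.
  by move/eqP: Ed; rewrite subn_eq0 leqNgt (leq_ltn_trans le_mj).
have lt_mn := leq_ltn_trans le_mj lt_jn.
have {}IH : int_closed n m.+1 by apply: IH => //; rewrite subnS Ed.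
apply: (span_linear (mull_linear (A j))) => _ [g [M [y [hM oy ->]]]].
rewrite -!mulrA mulrA; apply: normal_int_fun => b; rewrite mulrA.
have below i : (n <= i)%N -> M i j = 0.
  move=> le_ni; rewrite hM; first by rewrite gtn_eqF // (leq_trans lt_jn).
  by rewrite [(i < n)%N]ltnNge le_ni andbF.
have above i : (i < m)%N -> M i j = 0.
  move=> lt_im; rewrite hM; first by rewrite ltn_eqF // (leq_trans lt_im).
  by rewrite [(m <= i)%N]leqNgt lt_im.
have [ex_i|no_i] := pselect (exists i, M i j != 0); last first.
  rewrite int_sub0 => [|k].
    rewrite -mulrA; apply: normal_fun; apply: normal_sub => //.
    exact: normal_ordered.
  by apply/eqP; apply: contra_notT no_i => Mk; exists k.
case: (ex_minnP ex_i) => i Mij i_min.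
have lt_in : (i < n)%N by rewrite ltnNge; apply: contra Mij => /below ->.
have le_mi : (m <= i)%N by rewrite leqNgt; apply: contra Mij => /above ->.
have M0 k : (k < i)%N -> M k j = 0.
  by move=> lt_ki; apply/eqP; apply: contraTT lt_ki; rewrite -leqNgt; apply: i_min.
apply: (span_linear (mulr_linear y)) (int_sub b lt_in lt_jn
  (supported_in_below hM) Mij M0) => _ [h [b1 [v ->]]].
rewrite -!mulrA; apply: normal_fun; apply: normal_oneB_sub.
  by apply: mE_supported_in; rewrite le_mj.
apply: normal_sub; last exact: normal_line_ordered.
by apply: mmul_supported_in => //; apply: mL_supported_in.
Qed.

Definition fits n (t : generator B) : Prop :=
  match t with
  | gen_fun _ => True
  | gen_sub M => supported_below n M
  | gen_int i => (i < n)%N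
  end.

Lemma normal_gen n t x : fits n t -> normal n 0 x -> normal n 0 (cls (fgen t) * x).
Proof.
case: t => [g|M|i] /= ft nx.
- by rewrite -pclass_fun; apply: normal_fun.
- by rewrite -pclass_sub; apply: normal_sub nx; apply: supported_below_in.
- by rewrite -pclass_int; apply: int_closedP.
Qed.

Lemma ordered_product_seq n m y : ordered_product n m y ->
  exists J : seq (nat * R),
    [/\ forall t, t \in J -> line_integrator t.1 t.2,
      all (leq m) (unzip1 J), sorted ltn (unzip1 J) & y = \prod_(t <- J) t.2].
Proof.
elim=> {m y} [m|m i b v y le_mi lt_in Sb oy [J [Jl Jm Js ->]]].
  by exists [::]; rewrite big_nil.
exists ((i, line n i b v) :: J); rewrite big_cons; split=> //=.
- move=> t; rewrite inE => /predU1P [->|/Jl//]; exists b, n, v; split=> //=.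
  by rewrite line.unlock op_fun.unlock op_sub.unlock op_int.unlock pclass.unlock.
- by rewrite le_mi; apply: sub_all Jm => k /ltnW; apply: leq_trans.
- by rewrite path_min_sorted.
Qed.

(** * Normal terms *)

(** If the row of M that belongs to the first line integrator vanishes, then
    so does the whole term; otherwise expanding g gives normal terms. *)
Lemma normal_term_normal n x : normal n 0 x -> span (@normal_term K B H S) x.
Proof.
apply: span_bind => _ [g [M [y [hM oy ->]]]].
have [J [Jl _ Js ->]] := ordered_product_seq oy.
have [M0|M0] := pselect (exists i t, J = i :: t /\ forall k, M i.1 k = 0).
  case: M0 => i [t [EJ M0]]; have /Jl [b [k [v [_ _ E]]]] : i \in J.
    by rewrite EJ mem_head.
  rewrite EJ big_cons -mulrA (mulrA (Sub M)) E -!mulrA.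
  have -> : pio_int H S i.1 = A i.1 by rewrite op_int.unlock pclass.unlock.
  rewrite (mulrA (Sub M)) sub_int // mul0r mulr0; exact: span0.
have Fl : linear (fun g => F g * Sub M * \prod_(t <- J) t.2).
  by move=> c u v; rewrite funD funZ !mulrDl !pio_scalerAl.
elim/tensor_ind: g => [|f|u v hu hv|c u hu].
- rewrite (linear0f Fl); exact: span0.
- apply: (span_linear Fl) (pure_basis f S_basis S_one) => _ [f' [f'S _ ->]].
  apply: span_gen; exists (pure f'), M, J; split=> //.
  + by exists f'.
  + move=> i t EJ; apply/not_existsP => Mi; apply: M0; exists i, t; split=> // k.
    by apply/eqP; apply: contra_notT (Mi k).
  + by rewrite op_fun.unlock op_sub.unlock pclass.unlock.
- by rewrite (linearDf Fl); apply: spanD.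
- by rewrite (linearZf Fl); apply: spanZ.
Qed.

(** A word has finitely many letters, so a single size n fits all its matrices
    and indices, and its letters can be multiplied from the left one by one. *)
Lemma span_normal_term x : span (@normal_term K B H S) x.
Proof.
have [p ->] := pclass_surj x; rewrite [p]monalgE.
elim/big_rec: _ => [|k q _ hq]; first by rewrite pclass0; apply: span0.
rewrite pclassD; apply: spanD hq; rewrite malgUZ pclassZ; apply: spanZ.
case: k => w.
have [n wn] : exists n, forall t, t \in w -> fits n t.
  elim: w => [|t w [n wn]]; first by exists 0%N.
  have [n' tn'] : exists n', forall n, (n' <= n)%N -> fits n t.
    case: t => [g|M|i] /=.
    - by exists 0%N.
    - exists (msize M) => n' le_n i j h; apply: msizeP.
      by case/orP: h => /(leq_trans le_n) ->; rewrite ?orbT.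
    - by exists i.+1.
  exists (maxn n n') => u; rewrite inE => /predU1P [->|/wn fu].
    by apply: tn'; apply: leq_maxr.
  case: u fu => [g|M|i] //= fu; last by rewrite leq_max fu.
  move=> i j h; apply: fu.
  by case/orP: h; rewrite geq_max => /andP [-> _]; rewrite ?orbT.
apply: (@normal_term_normal n); elim: w wn => [|t w IH] wn.
  have -> : << FMonom [::] >> = 1 :> free_alg B.
    by congr (<< _ >>); apply/eqP; rewrite fmP /= fm1.
  by rewrite pclass1; apply: normal_ordered; apply: ordered_product1.
have -> : << FMonom (t :: w) >> = fgen t * << FMonom w >> :> free_alg B.
  rewrite [RHS]fgmulUU mulr1; congr (<< _ >>); apply/eqP.
  by rewrite fmP /= fmM fmU.
rewrite pclassM; apply: normal_gen; first by apply: wn; rewrite mem_head.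
by apply: IH => u uw; apply: wn; rewrite inE uw orbT.
Qed.

End Operators.

Theorem theorem4p11 (K : fieldType) (charK : [pchar K] =i pred0)
    (B : comAlgType K) (H : scaled_RB_bialgebra B)
    (S : B -> Prop) (S_basis : is_basis S) (S_one : S 1)
    (x : pio H S) :
  span (@normal_term K B H S) x.
Proof. exact: span_normal_term S_basis.1 S_one x. Qed.
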